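(* Assume (F1), (F2), (H1), (H2). Then for each $c>c^*$, the travelling wave problem with speed $c$ admits a solution $\phi$ satisfying $0<\phi(\xi)<K$ and $\phi'(\xi)>0$ for all $\xi\in\mathbb{R}$, and $$\lim_{\xi\to-\infty}\phi(\xi)e^{-\lambda\xi}=1,\qquad \lim_{\xi\to-\infty}\phi'(\xi)e^{-\lambda\xi}=\lambda,$$ where $\lambda=\lambda_1(c)$ is the smallest positive zero of $\Delta(c,\cdot)$.
   Context: Fix constants $d>0$, $\tau\geq0$, $K>0$, $f:[0,K]^2\to\mathbb{R}$ and $h:\mathbb{R}\to\mathbb{R}$ (partial derivatives of $f$ assumed to exist). (F1) $f\in C([0,K]^2,\mathbb{R})$, $f(0,0)=f(K,K)=0$, $f(u,u)>0$ for $u\in(0,K)$, $\partial_2f(u,v)\geq0$ on $[0,K]^2$. (F2) There exist $M>0$, $\sigma\in(0,1]$ with $0\leq \partial_1f(0,0)u+\partial_2f(0,0)v-f(u,v)\leq M(u+v)^{1+\sigma}$ on $[0,K]^2$, and $\partial_1f(K,K)+\partial_2f(K,K)<0$. (H1) $h\ge0$, even, integrable, $\int_{\mathbb{R}}h=1$. (H2) There is $\lambda_0\in(0,\infty]$ with $\int_0^\infty h(x)e^{\lambda x}dx<\infty$ for all $\lambda<\lambda_0$. Let $G(\lambda)=\int_{\mathbb{R}}h(y)e^{-\lambda y}dy$, $\lambda^+=\lambda_0$ if $\partial_2f(0,0)>0$ and $\lambda^+=+\infty$ otherwise, and $\Delta(c,\lambda)=c\lambda-d[e^{\lambda}+e^{-\lambda}-2]-\partial_1f(0,0)-\partial_2f(0,0)e^{-\lambda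 c\tau}G(\lambda)$. Let $c^*>0$ be the unique number for which there is $\lambda^*\in(0,\lambda^+)$ with $\Delta(c^*,\lambda^* )=0=\partial_\lambda\Delta(c^*,\lambda^* )$. Notation: $\Delta_1\phi(\xi)=\phi(\xi+1)-2\phi(\xi)+\phi(\xi-1)$, $(h*\phi)(\xi)=\int h(y)\phi(\xi-y)dy$. The travelling wave problem with speed $c>0$: find differentiable $\phi:\mathbb{R}\to\mathbb{R}$ with $-c\phi'(\xi)+d\Delta_1\phi(\xi)+f(\phi(\xi),(h*\phi)(\xi-c\tau))=0$ for all $\xi$, $\phi(-\infty)=0$, $\phi(+\infty)=K$, $0\le\phi\le K$. *)

(* Defs.v *)
From HB Require Import structures.
From mathcomp Require Import all_boot all_order all_algebra.
From mathcomp Require Import all_classical all_reals all_analysis.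
Set Implicit Arguments. Unset Strict Implicit. Unset Printing Implicit Defensive.
Import Order.TTheory GRing.Theory Num.Theory.
Import numFieldNormedType.Exports.
Local Open Scope classical_set_scope.
Local Open Scope ring_scope.

Section Defs.
Variable R : realType.

Definition box (K : R) : set (R * R) :=
  [set p | 0 <= p.1 <= K /\ 0 <= p.2 <= K].

(* derivative of g at x relative to the set A (one-sided at endpoints of an
   interval): the difference quotient tends to l as y -> x, y in A, y <> x *)
Definition has_deriv_within (A : set R) (g : R -> R) (x l : R) : Prop :=
  (fun y => (g y - g x) / (y - x)) @ within A (nbhs x^') --> l.

Definition is_partial1_on (K : R) (f D1 : R -> R -> R) : Prop :=
  forall u v, box K (u, v) ->
    has_deriv_within [set x | 0 <= x <= K] (fun x => f x v) u (D1 u v).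
Definition is_partial2_on (K : R) (f D2 : R -> R -> R) : Prop :=
  forall u v, box K (u, v) ->
    has_deriv_within [set x | 0 <= x <= K] (fun y => f u y) v (D2 u v).

Definition conv (h phi : R -> R) (xi : R) : R :=
  Rintegral lebesgue_measure setT (fun y => h y * phi (xi - y)).

Definition Gfun (h : R -> R) (lam : R) : R :=
  Rintegral lebesgue_measure setT (fun y => h y * expR (- lam * y)).

Definition Delta (d tau a1 a2 : R) (h : R -> R) (c lam : R) : R :=
  c * lam - d * (expR lam + expR (- lam) - 2)
  - a1 - a2 * expR (- lam * c * tau) * Gfun h lam.

Definition Delta1 (phi : R -> R) (xi : R) : R :=
  phi (xi + 1) - 2 * phi xi + phi (xi - 1).

Definition is_travelling_wave (d tau K : R) (f : R -> R -> R) (h : R -> R)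
    (c : R) (phi : R -> R) : Prop :=
  (forall xi, derivable phi xi 1) /\
  (forall xi, - c * derive1 phi xi + d * Delta1 phi xi
              + f (phi xi) (conv h phi (xi - c * tau)) = 0) /\
  (phi x @[x --> -oo] --> 0) /\
  (phi x @[x --> +oo] --> K) /\
  (forall xi, 0 <= phi xi <= K).

End Defs.

(* Main.v *)
(** The nonlinearity need not be Lipschitz in its first variable, so it is
replaced by its inf-convolutions f_n(u, v) = inf_w (f(w, v) + n |u - w|), which
are Lipschitz in u, still monotone in v, increase to f uniformly, and for large
n keep the tangent bounds of (F2).  With a large constant b, the profile
equation for f_n reads phi' + b phi = H(phi) with H order preserving.  Solving
y' + b y = H(psi) for the bounded solution y maps the functions between the
subsolution max(0, e^(l x) - q e^(m x)) and the supersolution min(K, e^(l x))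
to themselves, where l is the smallest zero of Delta(c, .) and m > l is slightly
larger, and Knaster-Tarski gives a least fixed point phi_n.  The next profile
phi_(n+1) is a supersolution for f_n, so phi_n increases with n; the limit
solves the equation for f and inherits the exponential bounds at -oo.  Where
phi' vanishes, Gronwall's inequality to the left makes phi constant, which is
impossible; the limit S of phi at +oo satisfies f(S, S) <= 0, whence S = K.
Finally l exists because Delta(c, .) is concave, negative at 0 and positive at
the point where Delta(c^*, .) vanishes. *)

Require Import Defs.
From HB Require Import structures.
From mathcomp Require Import all_boot all_order all_algebra.
From mathcomp Require Import all_classical all_reals all_analysis.
From mathcomp Require Import measurable_realfun zify ring lra.
Import Order.TTheory GRing.Theory Num.Theory.
Import numFieldNormedType.Exports.
Local Open Scope classical_set_scope.
Local Open Scope ring_scope.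

(** An order preserving [H] requires [f(u, v) + b u] to be nondecreasing in [u], hence a lower bound
    on the slopes of [f] in [u]; the mere existence of partial derivatives gives none. The constant
    [b] of the regularised problem grows with [n], and so does the Lipschitz bound that the fixed
    point inherits from it; a bound of the right-hand side independent of [n] replaces it in the
    limit. Differentiability of [f] in [u] returns in the strict monotonicity of the profile, where
    a Lipschitz bound centred at a single point suffices for Gronwall. The choice [m <= (1 + s) l]
    comes from (F2): its error is of size [exp ((1 + s) l x)], which for [x <= 0] is at most
    [exp (m x)] and is then paid for by [Delta(c, m) > 0] times a large [q]. The limit of [phi'] is
    found without differentiating the barriers: inserting them in the right-hand side of the
    equation gives the leading term, whose coefficient is [l] because [Delta(c, l) = 0]. *)

Local Notation conv := Defs.conv.
Local Notation leb := lebesgue_measure.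

(** * Linear first-order equations on the line: comparison and the bounded solution *)

Section Calculus.
Set Implicit Arguments. Unset Strict Implicit. Unset Printing Implicit Defensive.
Context {R : realType}.
Implicit Types (z dz H : R -> R) (a b x y : R).

Lemma is_derive_continuous {z x dzx} : is_derive x (1 : R) z dzx -> {for x, continuous z}.
Proof. by case=> dz _; exact/differentiable_continuous/derivable1_diffP. Qed.

Lemma mean_value z dz a b : a < b ->
  (forall x, a <= x <= b -> is_derive x (1 : R) z (dz x)) ->
  exists2 x, a < x < b & z b - z a = dz x * (b - a).
Proof.
move=> ab dzP; have [||x] := @MVT R z dz a b ab.
- by move=> x /[!in_itv]/= /andP[ax xb]; apply: dzP; rewrite !ltW.
- apply: continuous_in_subspaceT => x /[!inE]/= /[!in_itv]/= abx.
  exact: is_derive_continuous (dzP x abx).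
- by rewrite in_itv/= => axb ->; exists x.
Qed.

Lemma is_derive_expRM a x : is_derive x (1 : R) (fun y => expR (a * y)) (a * expR (a * x)).
Proof.
have dm : is_derive x (1 : R) (fun y => a * y) a.
  have := is_deriveZ a (is_derive_id x (1 : R)) => dm.
  by apply: (is_derive_eq dm); rewrite /GRing.scale/= mulr1.
have de := is_derive_expR (a * x).
have := is_derive1_comp de dm => dc; apply: (is_derive_eq dc); exact: mulrC.
Qed.

Lemma integrating_factor b z x dzx : is_derive x (1 : R) z dzx ->
  is_derive x (1 : R) (fun y => z y * expR (b * y)) ((dzx + b * z x) * expR (b * x)).
Proof.
move=> dz; have de := is_derive_expRM b x.
have dm := is_deriveM dz de; apply: (is_derive_eq dm).
by rewrite /GRing.scale/=; ring.
Qed.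

(* (z e^{bx})' >= 0 and z e^{bx} is at least -C e^{bx}, which tends to 0 at -oo. *)
Lemma comparison a b C z dz : 0 < b ->
  (forall x, x < a -> is_derive x (1 : R) z (dz x)) ->
  (forall x, x < a -> 0 <= dz x + b * z x) ->
  (forall x, x < a -> - C <= z x) ->
  forall x, x < a -> 0 <= z x.
Proof.
move=> b0 dzP dz0 zC x xa.
rewrite leNgt; apply/negP => zx0.
have C0 : 0 < C by have := zC x xa; lra.
have dP u s : u <= s <= x -> is_derive s (1 : R) z (dz s).
  by case/andP=> _ sx; apply: dzP; exact: le_lt_trans xa.
(* The second argument of the minimum solves [- C * expR (b * y) = z x * expR (b * x)]. *)
pose y := Num.min (x - 1) (x + ln (- z x / C) / b).
have yx : y < x by rewrite /y gt_min; apply/orP; left; lra.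
have [s /andP[ys sx]] := @mean_value (fun y => z y * expR (b * y))
   (fun y => (dz y + b * z y) * expR (b * y)) y x yx
  (fun s hs => integrating_factor b (dP _ s hs)).
have sa : s < a by exact: lt_trans xa.
have : 0 <= (dz s + b * z s) * expR (b * s) * (x - y).
  by rewrite !mulr_ge0 ?expR_ge0 ?dz0// subr_ge0 ltW.
move=> /[swap] <- /[!subr_ge0] h.
have ya : y < a by exact: lt_trans xa.
have h2 : - C * expR (b * y) <= z x * expR (b * x).
  by apply: le_trans h; rewrite ler_wpM2r ?expR_ge0// zC.
have h3 : expR (b * y) <= - z x / C * expR (b * x).
  rewrite -[- z x / C]lnK ?posrE ?divr_gt0 ?oppr_gt0//.
  rewrite -expRD ler_expR.
  have : y <= x + ln (- z x / C) / b by rewrite /y ge_min lexx orbT.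
  by rewrite -(ler_pM2l b0) mulrDr [b * (_ / b)]mulrCA divff ?gt_eqF// mulr1 addrC.
have h4 : expR (b * y) = - z x / C * expR (b * x).
  apply/eqP; rewrite eq_le h3/=.
  rewrite -(ler_pM2l C0) mulrA [C * (_ / C)]mulrCA divff ?gt_eqF// mulr1; lra.
(* At [y] the two bounds force only equality; any point further left makes one of them strict. *)
pose y' := y - 1.
have y'y : y' < y by rewrite /y'; lra.
have y'x := lt_trans y'y yx.
have [s' /andP[ys' sx']] := @mean_value (fun y => z y * expR (b * y))
   (fun y => (dz y + b * z y) * expR (b * y)) y' x y'x
  (fun s hs => integrating_factor b (dP _ s hs)).
have sa' : s' < a by exact: lt_trans xa.
have : 0 <= (dz s' + b * z s') * expR (b * s') * (x - y').
  by rewrite !mulr_ge0 ?expR_ge0 ?dz0// subr_ge0 ltW.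
move=> /[swap] <- /[!subr_ge0] h'.
have : - C * expR (b * y') <= z x * expR (b * x).
  by apply: le_trans h'; rewrite ler_wpM2r ?expR_ge0// zC// (lt_trans y'x).
have : expR (b * y') < expR (b * y) by rewrite ltr_expR ltr_pM2l.
rewrite -(ltr_pM2l C0) h4 mulrA [C * (_ / C)]mulrCA divff ?gt_eqF// mulr1; lra.
Qed.

Lemma integral_expR_Ny b u : 0 < b ->
  (\int[lebesgue_measure]_(x in `]-oo, u]) (expR (b * x))%:E = (expR (b * u) / b)%:E)%E.
Proof.
move=> b0.
have cexp (k : R) : continuous (fun x => expR (k * x)).
  by move=> x; exact: is_derive_continuous (is_derive_expRM k x).
rewrite -(opprK u) ge0_integration_by_substitutionNy; last 2 first.
- exact/continuous_subspaceT.
- by move=> x _; exact: expR_ge0.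
have dF (x : R) : is_derive x (1:R) (fun x => - b^-1 * expR (- b * x)) (expR (b * - x)).
  have dm := is_deriveZ (- b^-1) (is_derive_expRM (- b) x).
  apply: (is_derive_eq dm).
  by rewrite /GRing.scale/= mulrA mulrNN mulVf ?gt_eqF// mul1r mulNr mulrN.
rewrite (@ge0_continuous_FTC2y _ _ (fun x => - b^-1 * expR (- b * x)) _ 0)//.
- by rewrite sub0e; rewrite -EFinN (_ : - b * - u = b * - - u) ?mulNr ?opprK 1?mulrC//; ring.
- by move=> x _; exact: expR_ge0.
- apply: continuous_subspaceT => x /=.
  have -> : (expR (R:=R) \o *%R b) \o -%R = (fun x => expR (- b * x)).
    by apply/funext => y/=; rewrite mulrN mulNr.
  exact: cexp.
- rewrite -[X in _ --> X](mulr0 (- b^-1)); apply: cvgM; first exact: cvg_cst.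
  rewrite (_ : (fun x => expR (- b * x)) =
               (fun z : R => expR (- z)) \o (fun z : R => b * z)); last first.
    by apply: eq_fun => x; rewrite mulNr.
  apply: (@cvg_comp _ _ _ _ _ _ (pinfty_nbhs R)); last exact: cvgr_expR.
  exact: gt0_cvgMry.
- apply/cvg_at_right_filter; exact: is_derive_continuous (dF _).
- by move=> x _; rewrite derive1E (@derive_val _ _ _ _ _ _ _ (dF x)).
Qed.

(** Variation of constants started at -oo; since the homogeneous solutions [exp (- b x)] are
    unbounded there, this singles out the bounded solution of [y' + b y = H]. *)
Definition relax b H x : R :=
  expR (- b * x) * \int[lebesgue_measure]_(t in `]-oo, x]) (expR (b * t) * H t).

Lemma relax_spec b B H : 0 < b -> continuous H -> (forall x, 0 <= H x <= B) ->
  (forall x, is_derive x (1 : R) (relax b H) (H x - b * relax b H x)) /\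
  (forall x, 0 <= relax b H x <= B / b).
Proof.
move=> b0 cH HB.
have cexp (k : R) : continuous (fun x => expR (k * x)).
  by move=> x; exact: is_derive_continuous (is_derive_expRM k x).
have cE : continuous (fun t => expR (b * t) * H t).
  by move=> x; apply: cvgM; [exact: cexp|exact: cH].
have mE (D : set R) : measurable D ->
    measurable_fun D (fun t : R => expR (b * t) * H t).
  move=> mD; apply: measurable_funTS.
  exact: continuous_measurable_fun.
have iexp u : lebesgue_measure.-integrable `]-oo, u] (EFin \o (fun t => expR (b * t))).
  apply/integrableP; split.
    apply/measurable_EFinP; apply: measurable_funTS.
    exact: continuous_measurable_fun.
  under eq_integral do rewrite /= ger0_norm ?expR_ge0//.
  by rewrite integral_expR_Ny// ltry.
have iBexp u : lebesgue_measure.-integrable `]-oo, u] (EFin \o (fun t => B * expR (b * t))).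
  have h := integrableZl _ B (iexp u); apply: h; exact: measurable_itv.
have iE u : lebesgue_measure.-integrable `]-oo, u] (EFin \o (fun t => expR (b * t) * H t)).
  apply: (@le_integrable _ _ R lebesgue_measure _ _ _ (fun t : R => (B * expR (b*t))%:E)) => //.
  - by apply/measurable_EFinP; exact: mE.
  - move=> x _ /=; rewrite lee_fin !ger0_norm ?mulr_ge0 ?expR_ge0//.
    + by rewrite mulrC ler_wpM2r ?expR_ge0//; case/andP: (HB x).
    + by have /andP[h1 h2] := HB x; exact: le_trans h2.
    + by case/andP: (HB x).
have expK (x : R) : expR (b * x) * expR (- b * x) = 1 by rewrite -expRD mulNr subrr expR0.
pose F x := \int[lebesgue_measure]_(t in `]-oo, x]) (expR (b * t) * H t).
split=> x.
  have xx1 : x < x + 1 by lra.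
  have hF := (fun ninf => continuous_FTC1 xx1 (iE _) ninf (cE x)).
  have [dF F'] : derivable F x 1 /\ derive1 F x = expR (b * x) * H x.
    by apply: hF; rewrite ltNyr.
  have dFx : is_derive x (1 : R) F (expR (b * x) * H x).
    by apply: DeriveDef => //; rewrite -derive1E.
  have := integrating_factor (- b) dFx.
  rewrite (_ : (fun y => _) = relax b H); last first.
    by apply/funext => y; rewrite /relax mulrC.
  move=> h; apply: (is_derive_eq h).
  transitivity (expR (b * x) * expR (- b * x) * H x - b * (expR (- b * x) * F x)); first ring.
  by rewrite expK mul1r.
rewrite /relax mulr_ge0 ?expR_ge0//=; last first.
  apply: Rintegral_ge0 => t _; rewrite mulr_ge0 ?expR_ge0//.
  by case/andP: (HB t).
have : F x <= \int[lebesgue_measure]_(t in `]-oo, x]) (B * expR (b * t)).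
  apply: le_Rintegral => //.
  by move=> t _; rewrite mulrC ler_wpM2r ?expR_ge0//; case/andP: (HB t).
rewrite RintegralZl// /Rintegral integral_expR_Ny//= => h.
apply: le_trans (ler_wpM2l (expR_ge0 _) h) _.
have -> : expR (- b * x) * (B * (expR (b * x) / b)) = expR (b * x) * expR (- b * x) * (B / b).
  by ring.
by rewrite expK mul1r.
Qed.

(** The difference [z - relax b H] satisfies the hypotheses of [comparison]. Monotonicity of [relax]
    in [x] and in [H], the upper barrier and minimality all reduce to this statement. *)
Lemma relax_le b B z dz H : 0 < b -> continuous H -> (forall x, 0 <= H x <= B) ->
  (forall x, is_derive x (1 : R) z (dz x)) -> (forall x, H x <= dz x + b * z x) ->
  (exists C, forall x, - C <= z x) ->
  forall x, relax b H x <= z x.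
Proof.
move=> b0 cH HB dzP hz [C zC] x; have [dr rB] := @relax_spec b B H b0 cH HB.
rewrite -subr_ge0.
apply: (@comparison (x + 1) b (C + B / b) (fun y => z y - relax b H y)
  (fun y => dz y - (H y - b * relax b H y))) => //.
- by move=> y _; have := hz y; lra.
- move=> y _; have := zC y; have := rB y; lra.
- lra.
Qed.

End Calculus.

(** * Convolution with the probability density [h] *)

Section Convolution.
Set Implicit Arguments. Unset Strict Implicit. Unset Printing Implicit Defensive.
Context {R : realType}.
Variable h : R -> R.
Hypothesis h0 : forall x, 0 <= h x.
Hypothesis hint : leb.-integrable setT (EFin \o h).
Hypothesis h1 : (\int[leb]_x (h x)%:E = 1%:E)%E.
Implicit Types (psi : R -> R) (x y : R).

Lemma kernel_measurable : measurable_fun setT h.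
Proof. by apply/measurable_EFinP; case/integrableP : hint. Qed.

Lemma continuous_reflect psi x : continuous psi -> continuous (fun y => psi (x - y)).
Proof.
move=> cpsi y; apply: (@continuous_comp _ _ _ (fun y => x - y) psi); last exact: cpsi.
by apply: cvgB; [exact: cvg_cst|exact: cvg_id].
Qed.

Lemma conv_integrable (B : R) psi x : continuous psi -> (forall y, `|psi y| <= B) ->
  leb.-integrable setT (EFin \o (fun y => h y * psi (x - y))).
Proof.
move=> cpsi psiB.
have ih : leb.-integrable setT (EFin \o (fun y => B * h y)).
  have hh := integrableZl measurableT B hint; exact: hh.
apply: (@le_integrable _ _ R leb _ _ _ (EFin \o (fun y => B * h y))) => //.
  apply/measurable_EFinP; apply: measurable_funM; first exact: kernel_measurable.
  by apply: continuous_measurable_fun; exact: continuous_reflect.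
move=> y _ /=; rewrite lee_fin !normrM (ger0_norm (h0 y)) mulrC ler_wpM2r// ler_normr.
by rewrite psiB.
Qed.

Lemma conv_le (B1 B2 : R) psi1 psi2 x :
  continuous psi1 -> (forall y, `|psi1 y| <= B1) ->
  continuous psi2 -> (forall y, `|psi2 y| <= B2) ->
  (forall y, psi1 y <= psi2 y) -> conv h psi1 x <= conv h psi2 x.
Proof.
move=> c1 b1 c2 b2 le12; apply: le_Rintegral => //.
- exact: conv_integrable b1.
- exact: conv_integrable b2.
- by move=> y _; rewrite ler_wpM2l.
Qed.

Lemma conv_cst (k : R) x : conv h (fun=> k) x = k.
Proof.
rewrite /conv; under eq_Rintegral do rewrite mulrC.
by rewrite RintegralZl// /Rintegral h1/= mulr1.
Qed.

Lemma conv_shift psi s x : conv h (fun y => psi (y + s)) x = conv h psi (x + s).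
Proof.
by apply: eq_Rintegral => y _; congr (_ * psi _); ring.
Qed.

Lemma conv_lipschitz (B L : R) psi x1 x2 : continuous psi -> (forall y, `|psi y| <= B) ->
  (forall y1 y2, `|psi y1 - psi y2| <= L * `|y1 - y2|) ->
  `|conv h psi x1 - conv h psi x2| <= L * `|x1 - x2|.
Proof.
move=> cpsi psiB psiL.
have i x := conv_integrable x cpsi psiB.
pose k := L * `|x1 - x2|.
have ik : leb.-integrable setT (EFin \o (fun y => k * h y)).
  have hh := integrableZl measurableT k hint; exact: hh.
have kE : \int[leb]_y (k * h y) = k by rewrite RintegralZl// /Rintegral h1/= mulr1.
have bnd y : `|psi (x1 - y) - psi (x2 - y)| <= k.
  by have := psiL (x1 - y) (x2 - y); rewrite (_ : x1 - y - (x2 - y) = x1 - x2)//; ring.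
suff key z1 z2 : (forall y, psi (z1 - y) <= psi (z2 - y) + k) ->
    conv h psi z1 <= conv h psi z2 + k.
  rewrite ler_norml lerBlDr lerBrDr -/k; apply/andP; split.
  - rewrite addrC lerBlDr; apply: key => y; have := bnd y; rewrite ler_norml; lra.
  - rewrite addrC; apply: key => y; have := bnd y; rewrite ler_norml; lra.
move=> le12; rewrite -[X in _ + X]kE /conv -RintegralD//.
apply: le_Rintegral => //.
- have hh := integrableD measurableT (i z2) ik; exact: hh.
- by move=> y _; have := ler_wpM2l (h0 y) (le12 y); rewrite mulrDr [k * _]mulrC.
Qed.

(** Dominated convergence with majorant [B * h]; pointwise convergence of the profiles is enough. *)
Lemma conv_cvg (B : R) (psi_ : nat -> R -> R) psi x :
  (forall n, continuous (psi_ n)) -> (forall n y, `|psi_ n y| <= B) -> continuous psi ->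
  (forall y, psi_ ^~ y @ \oo --> psi y) ->
  (fun n => conv h (psi_ n) x) @ \oo --> conv h psi x.
Proof.
move=> c_ b_ c cvg.
have psiB y : `|psi y| <= B.
  have cn : (fun n => `|psi_ n y|) @ \oo --> `|psi y| by exact: cvg_norm (cvg y).
   rewrite -(cvg_lim _ cn)//.
  by apply: limr_le; [exact: cvgP cn|apply: nearW => n; exact: b_].
have ih : leb.-integrable setT (EFin \o (fun y => B * h y)).
  have hh := integrableZl measurableT B hint; exact: hh.
have mp p : continuous p -> measurable_fun setT (fun y => h y * p (x - y)).
  move=> cp; apply: measurable_funM; first exact: kernel_measurable.
  by apply: continuous_measurable_fun; exact: continuous_reflect.
have [] := @dominated_convergence _ _ R leb setT measurableT
  (fun n => EFin \o (fun y => h y * psi_ n (x - y))) (EFin \o (fun y => h y * psi (x - y)))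
  (EFin \o (fun y => B * h y)).
- by move=> n /=; apply/measurable_EFinP; exact: mp.
- by apply/measurable_EFinP; exact: mp.
- apply/aeW => y _; apply: cvg_EFin; first exact: nearW.
  by apply: cvgM; [exact: cvg_cst|exact: cvg].
- exact: ih.
- apply/aeW => y n _ /=; rewrite lee_fin normrM (ger0_norm (h0 y)) mulrC ler_wpM2r//.
move=> _ _ /= cv.
have i n := conv_integrable x (c_ n) (b_ n).
apply: fine_cvg; rewrite fineK//.
apply: integrable_fin_num => //; exact: (conv_integrable x c psiB).
Qed.

Definition exp_integrable (l : R) := leb.-integrable setT (EFin \o (fun y => h y * expR (- l * y))).

Lemma conv_expR (l x : R) : exp_integrable l -> conv h (fun y => expR (l * y)) x = expR (l * x) * Gfun h l.
Proof.
move=> il; rewrite /conv /Gfun -RintegralZl//.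
apply: eq_Rintegral => y _; rewrite mulrCA -expRD; congr (_ * expR _); ring.
Qed.

Lemma conv_le_expR (B l : R) psi x : continuous psi -> (forall y, `|psi y| <= B) ->
  exp_integrable l -> (forall y, psi y <= expR (l * y)) ->
  conv h psi x <= expR (l * x) * Gfun h l.
Proof.
move=> c b il le; rewrite -conv_expR//; apply: le_Rintegral => //.
- exact: conv_integrable b.
- have hh := integrableZl measurableT (expR (l * x)) il.
  apply: eq_integrable hh => // y _ /=; rewrite -EFinM mulrCA -expRD; do 3 congr (_ _); ring.
- by move=> y _; rewrite ler_wpM2l.
Qed.

Lemma conv_ge_expRB (B l m q : R) psi x : continuous psi -> (forall y, `|psi y| <= B) ->
  exp_integrable l -> exp_integrable m ->
  (forall y, expR (l * y) - q * expR (m * y) <= psi y) ->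
  expR (l * x) * Gfun h l - q * (expR (m * x) * Gfun h m) <= conv h psi x.
Proof.
move=> c b il im le.
have ie k : exp_integrable k ->
    leb.-integrable setT (EFin \o (fun y => h y * expR (k * (x - y)))).
  move=> ik; have hh := integrableZl measurableT (expR (k * x)) ik.
  apply: eq_integrable hh => // y _ /=; rewrite -EFinM mulrCA -expRD; do 3 congr (_ _); ring.
have iqm : leb.-integrable setT (EFin \o (fun y => q * (h y * expR (m * (x - y))))).
  have hh := integrableZl measurableT q (ie _ im); exact: hh.
rewrite -!conv_expR// /conv -RintegralZl//; last exact: ie.
rewrite -RintegralB//; last exact: ie.
apply: le_Rintegral => //.
- have hh := integrableB measurableT (ie _ il) iqm; exact: hh.
- exact: conv_integrable b.
- move=> y _; have := ler_wpM2l (h0 y) (le (x - y)); apply: le_trans.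
  by rewrite le_eqVlt; apply/orP; left; apply/eqP; ring.
Qed.

End Convolution.

(** * Relative derivatives, and extension of [f] from the box to the plane *)

Section WithinBox.
Set Implicit Arguments. Unset Strict Implicit. Unset Printing Implicit Defensive.
Context {R : realType}.

(** Multiplying the quotient out makes the estimate valid at [y = x] too and gives at once a
    Lipschitz bound centred at [x]. *)
Lemma has_deriv_withinP (A : set R) (g : R -> R) (x l : R) : has_deriv_within A g x l ->
  forall e, 0 < e -> exists2 r, 0 < r &
    forall y, A y -> `|y - x| < r -> `|g y - g x - l * (y - x)| <= e * `|y - x|.
Proof.
move=> /cvgrPdist_lt hd e e0.
have /nbhs_ballP[r r0 hr] : \forall y \near x, y != x -> A y ->
    `|l - (g y - g x) / (y - x)| < e by exact: (hd e e0).
exists r => // y Ay yxr.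
have [->|yx] := eqVneq y x; first by rewrite !subrr mulr0 subr0 normr0 mulr0.
have yx0 : y - x != 0 by rewrite subr_eq0.
have /(hr y)/(_ yx Ay) lq : ball x r y by rewrite /ball/= distrC.
rewrite (_ : g y - g x - l * (y - x) = ((g y - g x) / (y - x) - l) * (y - x)); last first.
  by field.
by rewrite normrM ler_wpM2r// distrC ltW.
Unshelve. all: by end_near. Qed.

(** The criterion is a closed inequality without division, so for the limit profile it can be
    obtained by letting [n] tend to infinity. *)
Lemma is_derive_dist (g : R -> R) (x l : R) :
  (forall e, 0 < e -> exists2 r, 0 < r &
    forall y, `|y - x| < r -> `|g y - g x - l * (y - x)| <= e * `|y - x|) ->
  is_derive x (1 : R) g l.
Proof.
move=> hd.
have cv : (fun h => h^-1 *: (g (h *: (1 : R) + x) - g x)) @ 0^' --> l.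
  apply/cvgrPdist_le => e e0; have [r r0 hr] := hd e e0.
  near=> h.
  have h0 : h != 0 by near: h; exact: nbhs_dnbhs_neq.
  have hr' : `|h| < r by near: h; exact: dnbhs0_lt.
  have E : h *: (1 : R) + x = h + x by rewrite /GRing.scale/= mulr1.
  have := hr (h + x); rewrite E addrK => /(_ hr').
  rewrite -(@ler_pM2r _ `|h| _ `|l - _|) ?normr_gt0// -normrM.
  by rewrite (_ : (l - _) * h = - (g (h + x) - g x - l * h)) ?normrN// /GRing.scale/=; field.
by apply: DeriveDef; [exact: cvgP cv|exact: cvg_lim cv].
Unshelve. all: by end_near. Qed.

Lemma has_deriv_within_is_derive (A : set R) (g : R -> R) (x l : R) :
  nbhs x A -> has_deriv_within A g x l -> is_derive x (1 : R) g l.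
Proof.
move=> /nbhs_ballP[s /= s0 sA] /has_deriv_withinP hd.
apply: is_derive_dist => e /hd[r r0 hr]; exists (Num.min r s); first by rewrite lt_min r0.
move=> y; rewrite lt_min => /andP[yr ys]; apply: hr => //.
by apply: sA; rewrite /ball/= distrC.
Qed.

Definition clamp (K x : R) : R := Num.max 0 (Num.min x K).

Lemma clamp_itv K x : 0 <= K -> 0 <= clamp K x <= K.
Proof. by move=> K0; rewrite /clamp le_max lexx/= ge_max K0 ge_min lexx orbT. Qed.

Lemma clamp_id K x : 0 <= x <= K -> clamp K x = x.
Proof. by case/andP=> x0 xK; rewrite /clamp min_l// max_r. Qed.

Lemma clamp_le K x y : x <= y -> clamp K x <= clamp K y.
Proof.
move=> xy; rewrite /clamp ge_max !le_max lexx/= le_min !ge_min xy lexx/= !orbT//.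
Qed.

Lemma clamp_lip K x y : `|clamp K x - clamp K y| <= `|x - y|.
Proof.
wlog xy : x y / x <= y.
  move=> H; have [/H//|/ltW /H] := leP x y.
  by rewrite distrC [X in _ <= X]distrC.
rewrite distrC [X in _ <= X]distrC !ger0_norm ?subr_ge0 ?clamp_le//.
rewrite /clamp; have [] := leP x K; have [] := leP y K => *; have [] := leP 0 x => *;
 have [] := leP 0 y => *; have [] := leP 0 K => *; lra.
Qed.

Variables (K : R) (f : R -> R -> R).
Hypothesis K0 : 0 < K.
Hypothesis fc : {within box K, continuous (fun p : R * R => f p.1 p.2)}.

Lemma compact_box : compact (box K).
Proof.
have -> : box K = `[0, K]%classic `*` `[0, K]%classic.
  by apply/seteqP; split => -[a b] /=; rewrite !in_itv.
by apply: compact_setX; exact: segment_compact.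
Qed.

(** [clamp K] is monotone and nonexpansive, so boundedness, uniform continuity and monotonicity in
    [v] hold on the whole plane without side conditions. *)
Definition extend u v : R := f (clamp K u) (clamp K v).

Lemma extend_bounded : exists B, forall u v, `|extend u v| <= B.
Proof.
have := compact_bounded (continuous_compact fc compact_box).
move=> [M [Mr HM]]; exists (M + 1) => u v.
apply: (HM (M + 1)); first by rewrite ltrDl.
by exists (clamp K u, clamp K v) => //=; split; apply: clamp_itv; exact: ltW.
Qed.

Lemma extend_unif e : 0 < e -> exists2 r, 0 < r & forall u u' v v',
  `|u - u'| < r -> `|v - v'| < r -> `|extend u v - extend u' v'| < e.
Proof.
move=> e0.
pose P (r : R) (p : R * R) := forall q, box K q -> `|p.1 - q.1| < r -> `|p.2 - q.2| < r ->
  `|f p.1 p.2 - f q.1 q.2| < e.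
have cov : \forall r \near 0^'+, box K `<=` P r.
  have /near_covering_withinP H := (compact_near_coveringP _).1 compact_box.
  apply: H => p Kp.
  have /cvgrPdist_lt/(_ (e / 2)) : (fun p : R * R => f p.1 p.2) @ within (box K) (nbhs p) --> f p.1 p.2.
    exact: (subspace_continuousP _ _).1 fc p Kp.
  rewrite divr_gt0// => /(_ isT); rewrite near_withinE => /nbhs_ballP[r /= r0 hr].
  (* Half of the radius is for [p'] and half for the distance from [p'] to [q], so both points lie
     where [f] is within [e / 2] of its value at [p]. *)
  exists (ball p (r / 2), [set s : R | 0 < s < r / 2]).
    split; first by apply: nbhsx_ballx; rewrite divr_gt0.
    by near=> s; apply/andP; split; near: s; [exact: nbhs_right_gt|apply: nbhs_right_lt; rewrite divr_gt0].
  move=> [p' s] /= [[p1 p2] /andP[s0 sr]] Kp' q Kq q1 q2.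
  move: p1 p2; rewrite /ball/= => p1 p2.
  have bp' : ball p r p' by split; rewrite /ball/=; [apply: lt_trans p1 _|apply: lt_trans p2 _]; lra.
  have bq : ball p r q.
    split; rewrite /ball/=.
    - by have := ler_distD p'.1 p.1 q.1; lra.
    - by have := ler_distD p'.2 p.2 q.2; lra.
  have := hr _ bp' Kp'; have := hr _ bq Kq => /=.
  have := ler_distD (f p.1 p.2) (f p'.1 p'.2) (f q.1 q.2).
  by rewrite (distrC (f p'.1 _) (f p.1 _)); lra.
have : \forall r \near 0^'+, 0 < r /\ box K `<=` P r.
  by apply: filterS2 cov (nbhs_right_gt 0).
move=> /filter_ex[r [r0 hr]]; exists r => // u u' v v' uu vv.
apply: (hr (clamp K u, clamp K v) _ (clamp K u', clamp K v')) => /=.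
- by split; apply: clamp_itv; exact: ltW.
- by split; apply: clamp_itv; exact: ltW.
- exact: le_lt_trans (clamp_lip _ _ _) uu.
- exact: le_lt_trans (clamp_lip _ _ _) vv.
Unshelve. all: by end_near. Qed.

Lemma extend_continuous_r u : continuous (extend u).
Proof.
move=> v; apply/cvgrPdist_lt => e /extend_unif[r r0 hr]; apply/nbhs_ballP; exists r => // v' vv'.
by apply: hr; rewrite ?subrr ?normr0.
Qed.

(** The mean value theorem is applied between the clamped arguments: the open interval between them
    is interior to [[0, K]], where the relative derivative is an ordinary one. *)
Lemma extend_le_r D2 : is_partial2_on K f D2 -> (forall u v, box K (u, v) -> 0 <= D2 u v) ->
  forall u v v', v <= v' -> extend u v <= extend u v'.
Proof.
move=> hD D0 u v v' vv'.
have cK w := clamp_itv w (ltW K0).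
have [E|ne] := eqVneq (clamp K v) (clamp K v'); first by rewrite /extend E.
have lt : clamp K v < clamp K v' by rewrite lt_neqAle ne clamp_le.
set w := clamp K u.
have E a : 0 <= a <= K -> extend u a = f w a by move=> aK; rewrite /extend (clamp_id aK).
have -> : extend u v = extend u (clamp K v) by rewrite /extend (clamp_id (cK v)).
have -> : extend u v' = extend u (clamp K v') by rewrite /extend (clamp_id (cK v')).
rewrite -subr_ge0.
have [||a] := @MVT R (extend u) (D2 w) _ _ lt.
- move=> a /[!in_itv]/= /andP[va av'].
  have a0 : 0 < a by apply: le_lt_trans va; case/andP: (cK v).
  have aK : a < K by apply: lt_le_trans av' _; case/andP: (cK v').
  have nb : nbhs a [set x | 0 <= x <= K].
    have : a \in `]0, K[ by rewrite in_itv/= a0.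
    move=> /near_in_itvoo; apply: filterS => b /[!in_itv]/= /andP[b0 bK].
    by rewrite !ltW.
  apply: (@near_eq_is_derive _ _ _ (f w)).
  + near=> b; rewrite E//; near: b; exact: nb.
  + have bx : box K (w, a) by split; rewrite /= ?cK// !ltW.
    exact: (has_deriv_within_is_derive nb (hD w a bx)).
- by apply: continuous_subspaceT; exact: extend_continuous_r.
- rewrite in_itv/= => /andP[va av'] ->; rewrite mulr_ge0 ?subr_ge0 ?(ltW lt)//.
  apply: D0; split; rewrite /= ?cK//; apply/andP; split.
  + by apply: le_trans (ltW va); case/andP: (cK v).
  + by apply: le_trans (ltW av') _; case/andP: (cK v').
Unshelve. all: by end_near. Qed.

End WithinBox.

(** * Lipschitz regularisation by inf-convolution *)

Section InfConvolution.
Set Implicit Arguments. Unset Strict Implicit. Unset Printing Implicit Defensive.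
Context {R : realType}.
Variables (K B : R) (F : R -> R -> R).
Hypothesis K0 : 0 <= K.
Hypothesis FB : forall u v, `|F u v| <= B.
Implicit Types (n : nat) (u v : R).

(** On [[0, K]] this is the largest [n]-Lipschitz function of [u] below [F] (the Pasch-Hausdorff
    envelope). *)
Definition infconv n u v : R :=
  inf [set F w v + n%:R * `|u - w| | w in [set w | 0 <= w <= K]].

Lemma infconv_le n u v w : 0 <= w <= K -> infconv n u v <= F w v + n%:R * `|u - w|.
Proof.
move=> wK; apply: ge_inf; last by exists w.
exists (- B) => _ [s _ <-]; have := FB s v; rewrite ler_norml => /andP[h _].
by rewrite (le_trans h)// lerDl mulr_ge0.
Qed.

Lemma infconv_ge n u v m :
  (forall w, 0 <= w <= K -> m <= F w v + n%:R * `|u - w|) -> m <= infconv n u v.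
Proof.
move=> h; apply: lb_le_inf; last by move=> _ [w wK <-]; exact: h.
by exists (F 0 v + n%:R * `|u - 0|); exists 0 => //=; rewrite lexx.
Qed.

Lemma infconv_le_self n u v : 0 <= u <= K -> infconv n u v <= F u v.
Proof. by move=> /(infconv_le n u v); rewrite subrr normr0 mulr0 addr0. Qed.

Lemma infconv_norm n u v : 0 <= u <= K -> `|infconv n u v| <= B.
Proof.
move=> uK; rewrite ler_norml; apply/andP; split.
  apply: infconv_ge => w _; have := FB w v; rewrite ler_norml => /andP[h _].
  by rewrite (le_trans h)// lerDl mulr_ge0.
by apply: le_trans (infconv_le_self n v uK) _; have := FB u v; rewrite ler_norml => /andP[].
Qed.

Lemma infconv_le_index n m u v : (n <= m)%N -> infconv n u v <= infconv m u v.
Proof.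
move=> nm; apply: infconv_ge => w wK; apply: le_trans (infconv_le n u v wK) _.
by rewrite lerD2l ler_wpM2r// ler_nat.
Qed.

Lemma infconv_lip n u1 u2 v : infconv n u1 v <= infconv n u2 v + n%:R * `|u1 - u2|.
Proof.
rewrite -lerBlDr; apply: infconv_ge => w wK; rewrite lerBlDr.
apply: le_trans (infconv_le n u1 v wK) _.
by rewrite -addrA -mulrDr lerD2l ler_wpM2l//; have := ler_distD u2 u1 w; lra.
Qed.

Lemma infconv_shift_r n u v1 v2 e :
  (forall w, 0 <= w <= K -> F w v1 <= F w v2 + e) -> infconv n u v1 <= infconv n u v2 + e.
Proof.
move=> h; rewrite -lerBlDr; apply: infconv_ge => w wK; rewrite lerBlDr.
by apply: le_trans (infconv_le n u v1 wK) _; have := h w wK; lra.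
Qed.

Lemma infconv_unif e :
  (exists2 r, 0 < r & forall u u' v v', `|u - u'| < r -> `|v - v'| < r -> `|F u v - F u' v'| < e) ->
  0 < e -> exists N, forall n u v, (N <= n)%N -> 0 <= u <= K -> F u v - e <= infconv n u v.
Proof.
(* With [n * r >= 2 * B] the penalty of a point [w] at distance at least [r] outweighs any drop of
   [F]; closer points change [F] by less than [e]. *)
move=> [r r0 hr] e0; exists (Num.truncn (B *+ 2 / r)).+1 => n u v Nn uK.
apply: infconv_ge => w wK.
have [uw|uw] := ltP `|u - w| r.
  have := hr u w v v uw; rewrite subrr normr0 => /(_ r0).
  have := mulr_ge0 (ler0n R n) (normr_ge0 (u - w)).
  by rewrite ltr_norml; lra.
have : B *+ 2 <= n%:R * r.
  rewrite -ler_pdivrMr//; apply/ltW/(lt_le_trans (truncnS_gt _)).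
  by rewrite ler_nat.
have := ler_wpM2l (ler0n R n) uw.
have := FB u v; have := FB w v; rewrite !ler_norml mulr2n; lra.
Qed.

(** Applied to the lower bound of (F2), whose Lipschitz constant on [[0, K]] is at most [n] once [n]
    is large. *)
Lemma infconv_minorant n (l : R -> R) u v : 0 <= u <= K ->
  (forall w, 0 <= w <= K -> l w <= F w v) ->
  (forall w, 0 <= w <= K -> l u <= l w + n%:R * `|u - w|) -> l u <= infconv n u v.
Proof.
move=> uK lF ll; apply: infconv_ge => w wK.
by apply: le_trans (ll w wK) _; rewrite lerD2r; exact: lF.
Qed.

End InfConvolution.

(** Mean value theorem, the derivative [(1 + s) a^s] being increasing; [x = 0] is separate because
    the derivative of the power is taken at positive bases. *)
Lemma powR1D_lip {R : realType} (s T x y : R) : 0 < s -> 0 <= x -> x <= y -> y <= T ->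
  y `^ (1 + s) - x `^ (1 + s) <= (1 + s) * T `^ s * (y - x).
Proof.
move=> s0 x0 xy yT.
have y0 : 0 <= y by lra.
have T0 : 0 <= T by lra.
have s1 : 0 < 1 + s by lra.
have Ts : 0 <= T `^ s by exact: powR_ge0.
have pw a : 0 <= a -> a `^ (1 + s) = a * a `^ s.
  by move=> a0; rewrite powRD ?powRr1// gt_eqF.
move: x0; rewrite le_eqVlt => /predU1P[<-|x0].
  rewrite powR0 ?gt_eqF// !subr0 pw//.
  have : y `^ s <= T `^ s by rewrite ge0_ler_powR ?nnegrE//; lra.
  move=> /(ler_wpM2l y0)/le_trans; apply; rewrite mulrC ler_wpM2r//.
  by rewrite ler_peMl//; lra.
move: xy; rewrite le_eqVlt => /predU1P[->|xy]; first by rewrite !subrr mulr0.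
have [|a /andP[xa ay] ->] := @mean_value R (fun a => a `^ (1 + s))
  (fun a => (1 + s) * a `^ (1 + s - 1)) x y xy.
  by move=> a /andP[xa _]; apply: is_derive1_powR; exact: lt_le_trans xa.
rewrite ler_wpM2r ?subr_ge0 ?(ltW xy)// ler_wpM2l ?(ltW s1)//.
rewrite (_ : 1 + s - 1 = s); last by ring.
by rewrite ge0_ler_powR ?nnegrE//; lra.
Qed.

(** * Least fixed point of the monotone integral operator *)

Section MinimalSolution.
Set Implicit Arguments. Unset Strict Implicit. Unset Printing Implicit Defensive.
Context {R : realType}.
Variables (b K : R) (lo up : R -> R) (H : (R -> R) -> R -> R).
Hypothesis b0 : 0 < b.

(** Monotonicity is built in so that the fixed point is a monotone front. Lipschitz continuity,
    unlike continuity, passes to infima of families with a common constant. *)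
Definition admissible (psi : R -> R) : Prop :=
  [/\ forall x y, x <= y -> psi x <= psi y,
      exists L, forall x y, `|psi x - psi y| <= L * `|x - y| &
      forall x, lo x <= psi x <= up x].

Hypothesis lo0 : forall x, 0 <= lo x.
Hypothesis up_adm : admissible up.
Hypothesis H_cont : forall psi, admissible psi -> continuous (H psi).
Hypothesis H_bnd : forall psi, admissible psi -> forall x, 0 <= H psi x <= b * K.
Hypothesis H_incr : forall psi x y, admissible psi -> x <= y -> H psi x <= H psi y.
Hypothesis H_mono : forall psi1 psi2 x, admissible psi1 -> admissible psi2 ->
  (forall y, psi1 y <= psi2 y) -> H psi1 x <= H psi2 x.
Hypothesis H_lo_up : forall psi x, admissible psi -> lo x <= relax b (H psi) x <= up x.

Lemma relax_derive psi : admissible psi ->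
  forall x, is_derive x (1 : R) (relax b (H psi)) (H psi x - b * relax b (H psi) x).
Proof. by move=> a; have [] := relax_spec b0 (H_cont a) (H_bnd a). Qed.

Lemma relax_itv psi x : admissible psi -> 0 <= relax b (H psi) x <= K.
Proof.
move=> a; have [_ /(_ x)] := relax_spec b0 (H_cont a) (H_bnd a).
by rewrite mulrAC divff ?gt_eqF// mul1r.
Qed.

Lemma relax_lip psi : admissible psi ->
  forall x y, `|relax b (H psi) x - relax b (H psi) y| <= b * K * `|x - y|.
Proof.
move=> a x y.
wlog xy : x y / x < y.
  move=> h; have [/h//|/h|->] := ltgtP x y; last by rewrite !subrr normr0 mulr0.
  by rewrite distrC [X in _ <= _ * X]distrC.
have [|s _] := mean_value xy (dz := fun x => H psi x - b * relax b (H psi) x) (z := relax b (H psi)).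
  by move=> s _; exact: relax_derive.
rewrite distrC [X in _ <= _ * X]distrC => ->; rewrite normrM ler_wpM2r//.
have := H_bnd a s; have /andP[r0 rK] := relax_itv s a.
have := ler_wpM2l (ltW b0) r0; have := ler_wpM2l (ltW b0) rK.
by rewrite ler_norml mulr0; lra.
Qed.

(** A left translate of the solution is a supersolution, because [H psi] is nondecreasing. *)
Lemma relax_incr psi x y : admissible psi -> x <= y -> relax b (H psi) x <= relax b (H psi) y.
Proof.
move=> a; rewrite -subr_ge0; set s := y - x => s0.
have -> : y = x + s by rewrite /s; ring.
have dS t : is_derive t (1 : R) (fun t => relax b (H psi) (t + s)) (H psi (t + s) - b * relax b (H psi) (t + s)).
  have ds : is_derive t (1 : R) (fun t => t + s) 1 by exact: is_derive_shift.
  have dc := @is_derive1_comp _ (relax b (H psi)) (fun t => t + s) t _ 1 (relax_derive a (t + s)) ds.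
  by apply: (is_derive_eq dc); rewrite mulr1.
apply: (relax_le b0 (H_cont a) (H_bnd a) dS).
- by move=> t; have := H_incr a (_ : t <= t + s); rewrite lerDl => /(_ s0); lra.
- by exists 0 => t; rewrite oppr0; case/andP: (relax_itv (t + s) a).
Qed.

Lemma relax_adm psi : admissible psi -> admissible (relax b (H psi)).
Proof.
move=> a; split; first by move=> x y; exact: relax_incr.
- by exists (b * K); exact: relax_lip.
- by move=> x; exact: H_lo_up.
Qed.

Lemma relax_supersolution psi dpsi : admissible psi ->
  (forall x, is_derive x (1 : R) psi (dpsi x)) -> (forall x, H psi x <= dpsi x + b * psi x) ->
  forall x, relax b (H psi) x <= psi x.
Proof.
move=> a dP h; apply: (relax_le b0 (H_cont a) (H_bnd a) dP h).
exists 0 => x; rewrite oppr0; have [_ _ /(_ x)/andP[l _]] := a.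
exact: le_trans (lo0 x) l.
Qed.

Lemma relax_mono psi1 psi2 x : admissible psi1 -> admissible psi2 ->
  (forall y, psi1 y <= psi2 y) -> relax b (H psi1) x <= relax b (H psi2) x.
Proof.
move=> a1 a2 le12; apply: (relax_le b0 (H_cont a1) (H_bnd a1) (relax_derive a2)).
- by move=> y; have := H_mono y a1 a2 le12; lra.
- by exists 0 => y; rewrite oppr0; case/andP: (relax_itv y a2).
Qed.

Let super psi := admissible psi /\ forall x, relax b (H psi) x <= psi x.
Let least x : R := inf [set relax b (H psi) x | psi in super].

Let least_le psi x : super psi -> least x <= relax b (H psi) x.
Proof.
move=> s; apply: ge_inf; last by exists psi.
by exists 0 => _ [p [a _] <-]; case/andP: (relax_itv x a).
Qed.

Let super_up : super up.
Proof. by split => // x; case/andP: (H_lo_up x up_adm). Qed.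

Let least_ge x m : (forall psi, super psi -> m <= relax b (H psi) x) -> m <= least x.
Proof.
move=> h; apply: lb_le_inf; first by exists (relax b (H up) x), up.
by move=> _ [p s <-]; exact: h.
Qed.

(* Knaster-Tarski; the infimum is taken over the images under [relax], whose
   Lipschitz constants are uniformly bounded. *)
Lemma minimal_solution : exists phi, [/\ admissible phi,
  forall x, is_derive x (1 : R) phi (H phi x - b * phi x) &
  forall psi dpsi, admissible psi -> (forall x, is_derive x (1 : R) psi (dpsi x)) ->
    (forall x, H psi x <= dpsi x + b * psi x) -> forall x, phi x <= psi x].
Proof.
have al : admissible least.
  split.
  - move=> x y xy; apply: least_ge => p s; apply: le_trans (least_le x s) _.
    exact: relax_incr s.1 xy.
  - exists (b * K) => x y.
    have key x1 x2 : least x1 <= least x2 + b * K * `|x1 - x2|.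
      rewrite -lerBlDr; apply: least_ge => p s; rewrite lerBlDr.
      apply: le_trans (least_le x1 s) _.
      have := relax_lip s.1 x1 x2; rewrite ler_norml; lra.
    have := key x y; have := key y x; rewrite (distrC y x) ler_norml; lra.
  - move=> x; apply/andP; split.
      by apply: least_ge => p s; case/andP: (H_lo_up x s.1).
    by apply: le_trans (least_le x super_up) _; case/andP: (H_lo_up x up_adm).
have sl : super least.
  split=> // x; apply: least_ge => p s; apply: relax_mono => //; first exact: s.1.
  by move=> y; apply: le_trans (least_le y s) _; exact: s.2.
have sr : super (relax b (H least)).
  split; first exact: relax_adm.
  by move=> x; apply: relax_mono => //; [exact: relax_adm|exact: sl.2].
(* The image of [least] is itself a supersolution, so [least] lies below its second image, hence
   below its first. *)
have E : least = relax b (H least).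
  apply/funext => x; apply/eqP; rewrite eq_le sl.2 andbT.
  by apply: le_trans (least_le x sr) _; exact: sr.2.
exists least; split => //.
- by move=> x; rewrite {1 3}E; exact: relax_derive.
- move=> p dp ap dP hp x.
  have sp : super p by split => //; exact: relax_supersolution dP hp.
  by apply: le_trans (least_le x sp) _; exact: sp.2.
Qed.

End MinimalSolution.

(** * The wave operator and its exponential barriers *)

Section WaveOperator.
Set Implicit Arguments. Unset Strict Implicit. Unset Printing Implicit Defensive.
Context {R : realType}.
Variables (d tau c K a1 a2 : R) (h : R -> R).
Hypothesis d0 : 0 < d.
Hypothesis c0 : 0 < c.
Hypothesis K0 : 0 < K.
Hypothesis a20 : 0 <= a2.
Hypothesis h0 : forall x, 0 <= h x.
Hypothesis hint : leb.-integrable setT (EFin \o h).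
Hypothesis h1 : (\int[leb]_x (h x)%:E = 1%:E)%E.
Implicit Types (psi phi : R -> R) (g : R -> R -> R).

Definition delayed psi x : R := conv h psi (x - c * tau).

Definition wave_rhs g psi x : R :=
  (d * Delta1 psi x + g (psi x) (delayed psi x)) / c.

(* [l] and [m] are the exponents of the super- and subsolution. *)
Variables (l m s q M : R).
Hypothesis l0 : 0 < l.
Hypothesis lm : l < m.
Hypothesis s0 : 0 < s.
Hypothesis ms : m <= (1 + s) * l.
Hypothesis M0 : 0 <= M.

Definition upper x : R := Num.min K (expR (l * x)).
Definition sub x : R := expR (l * x) - q * expR (m * x).
Definition lower x : R := Num.max 0 (sub x).
Local Notation adm := (admissible lower upper).

(** The factor by which the linearised delayed convolution multiplies [exp (p x)]. *)
Definition nonlocal (p : R) : R := a2 * (expR (- p * c * tau) * Gfun h p).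

(* The nonlocal variable occurs in the error term only when [a2 > 0]; otherwise
   [Gfun h] may fail to converge. *)
Definition active : R := if 0 < a2 then 1 else 0.

Definition tangent g := forall u v, 0 <= u <= K -> 0 <= v <= K ->
  a1 * u + a2 * v - M * (u + active * v) `^ (1 + s) <= g u v <= a1 * u + a2 * v.

Hypothesis exp_int : 0 < a2 -> exp_integrable h l /\ exp_integrable h m.

Lemma lipschitz_continuous L psi : (forall x y, `|psi x - psi y| <= L * `|x - y|) -> continuous psi.
Proof.
move=> psiL x; apply/cvgrPdist_lt => e e0; apply/nbhs_ballP.
have L1 : 0 < `|L| + 1 by rewrite ltr_wpDl.
exists (e / (`|L| + 1)) => [|y]; first by rewrite /= divr_gt0.
rewrite /ball/= ltr_pdivlMr// mulrC; apply: le_lt_trans; apply: le_trans (psiL x y) _.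
by rewrite ler_wpM2r//; have := ler_norm L; lra.
Qed.

Lemma adm_continuous psi : adm psi -> continuous psi.
Proof. by case=> _ [L psiL] _; exact: lipschitz_continuous psiL. Qed.

Lemma adm_itv psi : adm psi -> forall x, 0 <= psi x <= K.
Proof.
case=> _ _ lu x; have /andP[lo up] := lu x; apply/andP; split.
  by apply: le_trans lo; rewrite le_max lexx.
by apply: le_trans up _; rewrite ge_min lexx.
Qed.

Lemma adm_norm psi : adm psi -> forall x, `|psi x| <= K.
Proof. by move=> a x; have /andP[p0 pK] := adm_itv a x; rewrite ger0_norm. Qed.

Lemma adm_exp psi : adm psi -> forall x, psi x <= expR (l * x).
Proof.
case=> _ _ lu x; have /andP[_ up] := lu x.
by apply: le_trans up _; rewrite ge_min lexx orbT.
Qed.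

Lemma adm_sub psi : adm psi -> forall x, sub x <= psi x.
Proof.
case=> _ _ lu x; have /andP[lo _] := lu x.
by apply: le_trans lo; rewrite le_max lexx orbT.
Qed.

Lemma delayed_itv psi x : adm psi -> 0 <= delayed psi x <= K.
Proof.
move=> a; rewrite /delayed -{1}(@conv_cst _ h hint h1 0 (x - c * tau)).
rewrite -[X in _ && (_ <= X)](@conv_cst _ h hint h1 K (x - c * tau)).
have cst (k : R) : continuous (fun _ : R => k) by exact: cst_continuous.
have ck (k : R) (y : R) : `|(fun=> k) y| <= `|k| by [].
have cp := adm_continuous a; have np := adm_norm a.
apply/andP; split.
- by apply: (conv_le h0 hint _ (cst 0) (ck 0) cp np) => y; case/andP: (adm_itv a y).
- by apply: (conv_le h0 hint _ cp np (cst K) (ck K)) => y; case/andP: (adm_itv a y).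
Qed.

Lemma delayed_mono psi1 psi2 x : adm psi1 -> adm psi2 -> (forall y, psi1 y <= psi2 y) ->
  delayed psi1 x <= delayed psi2 x.
Proof.
move=> A1 A2; apply: (conv_le h0 hint).
- exact: adm_continuous.
- exact: adm_norm.
- exact: adm_continuous.
- exact: adm_norm.
Qed.

Lemma delayed_incr psi x y : adm psi -> x <= y -> delayed psi x <= delayed psi y.
Proof.
move=> a xy; rewrite /delayed (_ : y - c * tau = x - c * tau + (y - x)); last by ring.
rewrite -[X in _ <= X]conv_shift; apply: (@conv_le _ _ h0 hint K K _ _ _ (adm_continuous a) (adm_norm a)).
- move=> z; apply: (@continuous_comp _ _ _ (fun z => z + (y - x)) psi).
    by apply: cvgD; [exact: cvg_id|exact: cvg_cst].
  exact: adm_continuous.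
- by move=> z; exact: adm_norm.
- by move=> z; case: a => incr _ _; apply: incr; rewrite lerDl subr_ge0.
Qed.

Lemma delayed_lip L psi : adm psi -> (forall x y, `|psi x - psi y| <= L * `|x - y|) ->
  forall x y, `|delayed psi x - delayed psi y| <= L * `|x - y|.
Proof.
move=> a psiL x y.
have := conv_lipschitz h0 hint h1 (x - c * tau) (y - c * tau) (adm_continuous a) (adm_norm a) psiL.
by rewrite (_ : x - c * tau - (y - c * tau) = x - y)//; ring.
Qed.

Lemma Gfun_ge0 p : 0 <= Gfun h p.
Proof. by apply: Rintegral_ge0 => y _; rewrite mulr_ge0 ?expR_ge0. Qed.

Lemma delayed_le_exp psi x : 0 < a2 -> adm psi ->
  delayed psi x <= expR (l * x) * (expR (- l * c * tau) * Gfun h l).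
Proof.
move=> /exp_int[il _] a.
have := conv_le_expR h0 hint (x - c * tau) (adm_continuous a) (adm_norm a) il (adm_exp a).
by rewrite mulrA -expRD (_ : l * x + - l * c * tau = l * (x - c * tau))//; ring.
Qed.

Lemma delayed_ge_exp psi x : 0 < a2 -> adm psi ->
  expR (l * x) * (expR (- l * c * tau) * Gfun h l) -
    q * (expR (m * x) * (expR (- m * c * tau) * Gfun h m)) <= delayed psi x.
Proof.
move=> /exp_int[il im] a.
have := conv_ge_expRB h0 hint (x - c * tau) (adm_continuous a) (adm_norm a) il im (adm_sub a).
have E p : expR (p * (x - c * tau)) * Gfun h p = expR (p * x) * (expR (- p * c * tau) * Gfun h p).
  by rewrite mulrA -expRD; congr (expR _ * _); ring.
by rewrite (E l) (E m).
Qed.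

Lemma a2_cases : a2 = 0 \/ 0 < a2.
Proof. by move: a20; rewrite le_eqVlt => /predU1P[<-|]; [left|right]. Qed.

(** Bounding the profile by [exp (l x)] in both arguments of the (F2) error leaves this coefficient
    in front of [exp ((1 + s) l x)]. *)
Definition error_cst : R := M * (1 + active * (expR (- l * c * tau) * Gfun h l)) `^ (1 + s).

Lemma error_cst_ge0 : 0 <= error_cst.
Proof. by rewrite mulr_ge0 ?powR_ge0. Qed.

(** The local term stays [a1 * psi x], here and in the lower bound: the sign of [a1] is unknown, so
    replacing [psi] by a barrier is left to the stiffness. *)
Lemma nonlinearity_upper g psi x : tangent g -> adm psi ->
  g (psi x) (delayed psi x) <= a1 * psi x + nonlocal l * expR (l * x).
Proof.
move=> tg a; have /andP[_ H] := tg _ _ (adm_itv a x) (delayed_itv x a).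
apply: le_trans H _; rewrite lerD2l /nonlocal.
have [->|a2p] := a2_cases; first by rewrite !mul0r.
by rewrite -mulrA ler_wpM2l// mulrC delayed_le_exp.
Qed.

Lemma nonlinearity_lower g psi x : tangent g -> adm psi ->
  a1 * psi x + nonlocal l * expR (l * x) - q * (nonlocal m * expR (m * x))
    - error_cst * expR ((1 + s) * l * x) <= g (psi x) (delayed psi x).
Proof.
move=> tg a; have /andP[H _] := tg _ _ (adm_itv a x) (delayed_itv x a).
apply: le_trans H; apply: lerB.
  rewrite -addrA lerD2l /nonlocal.
  have [->|a2p] := a2_cases; first by rewrite !mul0r mulr0 subr0.
  have := ler_wpM2l a20 (delayed_ge_exp x a2p a); apply: le_trans.
  by rewrite le_eqVlt; apply/orP; left; apply/eqP; ring.
rewrite /error_cst -mulrA ler_wpM2l//.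
have s1 : 0 <= 1 + s by rewrite addr_ge0// ltW.
have act0 : 0 <= active by rewrite /active; case: ifP.
have e0 := expR_ge0 (l * x).
have g0 : 0 <= expR (- l * c * tau) * Gfun h l by rewrite mulr_ge0 ?expR_ge0 ?Gfun_ge0.
have -> : expR ((1 + s) * l * x) = expR (l * x) `^ (1 + s).
  by rewrite -expRM; congr expR; ring.
rewrite -powRM//; last by rewrite addr_ge0// mulr_ge0.
have /andP[p0 _] := adm_itv a x; have /andP[w0 _] := delayed_itv x a.
rewrite ge0_ler_powR ?nnegrE//; try by rewrite ?mulr_ge0// addr_ge0// mulr_ge0.
rewrite mulrDl mul1r lerD ?adm_exp// -mulrA /active; case: ifPn => [a2p|]; last by rewrite !mul0r.
by rewrite !mul1r mulrC delayed_le_exp.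
Qed.


Section Nonlinearity.
Variables (g : R -> R -> R) (n : R).
Hypothesis n0 : 0 <= n.
Hypothesis tg : tangent g.
Hypothesis gK : g K K <= 0.
Hypothesis g_lip : forall u1 u2 v, `|g u1 v - g u2 v| <= n * `|u1 - u2|.
Hypothesis g_mono : forall u v1 v2, v1 <= v2 -> g u v1 <= g u v2.
Hypothesis g_cont : forall e, 0 < e -> exists2 r, 0 < r & forall u v v', 0 <= u <= K ->
  `|v - v'| < r -> `|g u v - g u v'| <= e.

Hypothesis disp_l : c * l = d * (expR l + expR (- l) - 2) + a1 + nonlocal l.
Hypothesis disp_m : error_cst <= q * (c * m - d * (expR m + expR (- m) - 2) - a1 - nonlocal m).
Variable x1 : R.
Hypothesis x10 : x1 <= 0.
Hypothesis x1K : expR (l * x1) <= K.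
Hypothesis x1q : 1 <= q * expR ((m - l) * x1).

(* Large enough to make [relax_rhs] below order preserving. *)
Definition stiffness : R := 2 * d + n + `|a1| + 1.
Local Notation k := stiffness.

Definition relax_rhs psi x : R :=
  (d * Delta1 psi x + g (psi x) (delayed psi x) + k * psi x) / c.

Lemma q_gt0 : 0 < q.
Proof. by have := lt_le_trans ltr01 x1q; rewrite pmulr_lgt0// expR_gt0. Qed.

Lemma sub_le0 x : x1 <= x -> sub x <= 0.
Proof.
move=> xx; rewrite /sub (_ : m * x = l * x + (m - l) * x); last by ring.
rewrite expRD -[X in X - _]mulr1 mulrCA -mulrBr pmulr_rle0 ?expR_gt0// subr_le0.
apply: le_trans x1q _; rewrite ler_wpM2l ?(ltW q_gt0)// ler_expR ler_wpM2l// subr_ge0.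
exact: ltW.
Qed.

Lemma sub_leK x : sub x <= K.
Proof.
have [/sub_le0/le_trans|xx] := leP x1 x; first by apply; exact: ltW.
apply: le_trans x1K; apply: le_trans (_ : expR (l * x) <= _).
  by rewrite /sub gerBl mulr_ge0 ?expR_ge0// ltW// q_gt0.
by rewrite ler_expR ler_pM2l// ltW.
Qed.

Lemma upper_lip x y : `|upper x - upper y| <= l * K * `|x - y|.
Proof.
wlog xy : x y / x <= y.
  by move=> H; have [/H//|/ltW /H] := leP x y; rewrite distrC [X in _ <= _ * X]distrC.
have mono : upper x <= upper y.
  by rewrite /upper le_min ge_min lexx/= ge_min ler_expR ler_wpM2l ?orbT// ltW.
rewrite distrC [X in _ <= _ * X]distrC !ger0_norm ?subr_ge0//.
(* Used with [z = l * y] where the exponential is the minimum at [y], and with [z = ln K] where it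
   is cut off between [x] and [y]. *)
have key z : z <= l * y -> expR z <= K -> expR z - expR (l * x) <= l * K * (y - x).
  move=> zy zK; have [zx|zx] := leP z (l * x).
    have : expR z <= expR (l * x) by rewrite ler_expR.
    have : 0 <= l * K * (y - x) by rewrite !mulr_ge0 ?subr_ge0// ltW.
    by lra.
  have : expR z * (1 + (l * x - z)) <= expR (l * x).
    have -> : l * x = z + (l * x - z) by ring.
    by rewrite expRD ler_wpM2l ?expR_ge0// (_ : z + _ - z = l * x - z) ?expR_ge1Dx//; ring.
  have : expR z * (z - l * x) <= K * (z - l * x) by rewrite ler_wpM2r// subr_ge0 ltW.
  have : K * (z - l * x) <= K * (l * y - l * x) by rewrite ler_wpM2l ?(ltW K0)// lerD2r.
  by lra.
have [Ky|yK] := leP K (expR (l * y)); last first.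
  by rewrite {1}/upper min_r ?(ltW yK)// /upper min_r; [apply: key => //; exact: ltW|
    rewrite (le_trans _ (ltW yK))// ler_expR ler_wpM2l// ltW].
rewrite {1}/upper min_l// /upper; case: (leP K (expR (l * x))) => xK.
  by rewrite subrr !mulr_ge0 ?subr_ge0// ltW.
have := key (ln K); rewrite lnK ?posrE//; apply => //.
by rewrite -ler_expR lnK ?posrE.
Qed.

Lemma upper_adm : adm upper.
Proof.
split.
- move=> x y xy; rewrite /upper le_min ge_min lexx/= ge_min ler_expR ler_wpM2l ?orbT//.
  exact: ltW.
- by exists (l * K); exact: upper_lip.
- move=> x; rewrite lexx andbT /lower ge_max !le_min expR_ge0 sub_leK (ltW K0)/=.
  by rewrite /sub gerBl mulr_ge0 ?expR_ge0// ltW// q_gt0.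
Qed.

(** In [k], the part [2 * d] offsets the [-2] of the discrete Laplacian and [n] the Lipschitz
    constant of [g]; the rest is kept for the sign of [a1] and for positivity. *)
Lemma numerator_mono u1 u2 p1 p2 m1 m2 w1 w2 :
  u1 <= u2 -> p1 <= p2 -> m1 <= m2 -> w1 <= w2 ->
  d * (p1 - 2 * u1 + m1) + g u1 w1 + k * u1 <= d * (p2 - 2 * u2 + m2) + g u2 w2 + k * u2.
Proof.
move=> u p mm w.
have := ler_wpM2l (ltW d0) p; have := ler_wpM2l (ltW d0) mm.
have := g_mono u1 w; have := g_lip u1 u2 w2.
rewrite distrC [X in n * X]distrC [X in n * X]ger0_norm ?subr_ge0// ler_norml => /andP[g1 _] g2.
have : 0 <= (`|a1| + 1) * (u2 - u1) by rewrite mulr_ge0 ?subr_ge0// addr_ge0.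
rewrite /stiffness; lra.
Qed.

Lemma relax_rhs_mono psi1 psi2 x : adm psi1 -> adm psi2 -> (forall y, psi1 y <= psi2 y) ->
  relax_rhs psi1 x <= relax_rhs psi2 x.
Proof.
move=> A1 A2 le12; rewrite ler_pM2r ?invr_gt0// /Delta1.
by apply: numerator_mono => //; exact: delayed_mono.
Qed.

Lemma relax_rhs_incr psi x y : adm psi -> x <= y -> relax_rhs psi x <= relax_rhs psi y.
Proof.
move=> a xy; rewrite ler_pM2r ?invr_gt0// /Delta1; have [incr _ _] := a.
apply: numerator_mono; first exact: incr.
- by apply: incr; rewrite lerD2r.
- by apply: incr; rewrite lerD2r.
- exact: delayed_incr.
Qed.

Lemma g0_ge0 : 0 <= g 0 0.
Proof.
have z : 0 <= (0 : R) <= K by rewrite lexx ltW.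
have /andP[+ _] := tg z z.
by rewrite !mulr0 !addr0 powR0 ?mulr0 ?subr0// gt_eqF// ltr_wpDl.
Qed.

(** Comparison with the constants [0] and [K], where [g 0 0 >= 0] and [g K K <= 0]. *)
Lemma relax_rhs_bnd psi : adm psi -> forall x, 0 <= relax_rhs psi x <= k / c * K.
Proof.
move=> a x.
have bd y := adm_itv a y.
have /andP[w0 wK] := delayed_itv x a.
have /andP[u0 uK] := bd x; have /andP[p0 pK] := bd (x + 1); have /andP[m0 mK] := bd (x - 1).
apply/andP; split.
  rewrite divr_ge0 ?(ltW c0)// /Delta1.
  have := numerator_mono u0 p0 m0 w0.
  have -> : d * (0 - 2 * 0 + 0) + g 0 0 + k * 0 = g 0 0 by ring.
  by apply: le_trans; exact: g0_ge0.
rewrite mulrAC ler_pM2r ?invr_gt0// /Delta1.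
have := numerator_mono uK pK mK wK.
have -> : d * (K - 2 * K + K) = 0 by ring.
by move=> /le_trans; apply; rewrite add0r gerDr.
Qed.

Lemma relax_rhs_continuous psi : adm psi -> continuous (relax_rhs psi).
Proof.
move=> a; have cpsi := adm_continuous a.
have [_ [L psiL] _] := a.
have cdel := lipschitz_continuous (delayed_lip a psiL).
have cshift r : continuous (fun x => psi (x + r)).
  move=> x; apply: (@continuous_comp _ _ _ (fun z => z + r) psi); last exact: cpsi.
  by apply: cvgD; [exact: cvg_id|exact: cvg_cst].
have cg : continuous (fun x => g (psi x) (delayed psi x)).
  move=> x; apply/cvgrPdist_lt => e e0.
  have e2 : 0 < e / 2 by rewrite divr_gt0.
  have [r r0 hr] := g_cont e2.
  have n1 : 0 < n + 1 by rewrite ltr_wpDl.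
  have e3 : 0 < e / 2 / (n + 1) by rewrite divr_gt0.
  have /cvgrPdist_lt/(_ _ e3) nu := cpsi x.
  have /cvgrPdist_lt/(_ _ r0) nw := cdel x.
  apply: filterS2 nu nw => y u w.
  have h1' := hr _ _ _ (adm_itv a x) w.
  have h2' := g_lip (psi x) (psi y) (delayed psi y).
  move: u; rewrite ltr_pdivlMr// mulrC => u.
  have h3' : n * `|psi x - psi y| <= (n + 1) * `|psi x - psi y| by rewrite ler_wpM2r// lerDl.
  have := ler_distD (g (psi x) (delayed psi y)) (g (psi x) (delayed psi x)) (g (psi y) (delayed psi y)).
  by move: h1' h2' h3' u; lra.
move=> x; apply: cvgM; last exact: cvg_cst.
apply: cvgD; last by apply: cvgM; [exact: cvg_cst|exact: cpsi].
apply: cvgD; last exact: cg.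
apply: cvgM; first exact: cvg_cst.
apply: cvgD; last exact: cshift.
apply: cvgB; first exact: cshift.
by apply: cvgM; [exact: cvg_cst|exact: cpsi].
Qed.

Lemma k_gt0 : 0 < k.
Proof. by rewrite ltr_wpDl// addr_ge0// addr_ge0// mulr_ge0// ltW. Qed.

Lemma expR_shift (p x : R) : (expR (p * (x + 1)) = expR (p * x) * expR p) *
  (expR (p * (x - 1)) = expR (p * x) * expR (- p)).
Proof. by split; rewrite -expRD; congr expR; ring. Qed.

(** Since [k - 2 * d + a1 >= 0], the profile may be replaced by [exp (l x)] everywhere; [disp_l]
    then says that this exponential solves the linearised equation. *)
Lemma relax_rhs_upper psi x : adm psi ->
  relax_rhs psi x <= l * expR (l * x) + k / c * expR (l * x).
Proof.
move=> a.
have cN : c != 0 by rewrite gt_eqF.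
rewrite ler_pdivrMr// (_ : _ * c = (c * l + k) * expR (l * x)); last by field.
have e0 := adm_exp a x; have := adm_exp a (x + 1); have := adm_exp a (x - 1).
rewrite !expR_shift /Delta1 => /(ler_wpM2l (ltW d0)) em /(ler_wpM2l (ltW d0)) ep.
have nl := nonlinearity_upper x tg a.
have D := congr1 (fun z => z * expR (l * x)) disp_l.
have : 0 <= (k - 2 * d + a1) * (expR (l * x) - psi x).
  rewrite mulr_ge0 ?subr_ge0// /stiffness.
  by have := ler_norm (- a1); rewrite normrN; move: n0; lra.
by move: em ep nl D => /=; lra.
Qed.

(** For [x <= 0] the bound on [m] makes the (F2) error at most [error_cst * exp (m x)], which
    [disp_m] absorbs into the gain from [- q * exp (m x)]. *)
Lemma relax_rhs_lower psi x : adm psi -> x <= 0 ->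
  l * expR (l * x) - q * m * expR (m * x) + k / c * sub x <= relax_rhs psi x.
Proof.
move=> a x0.
have cN : c != 0 by rewrite gt_eqF.
rewrite ler_pdivlMr//.
have -> : (l * expR (l * x) - q * m * expR (m * x) + k / c * sub x) * c =
    c * l * expR (l * x) - q * (c * m * expR (m * x)) + k * sub x by field.
have e0 := adm_sub a x; have := adm_sub a (x + 1); have := adm_sub a (x - 1).
rewrite {1 2}/sub !expR_shift /Delta1 => /(ler_wpM2l (ltW d0)) em /(ler_wpM2l (ltW d0)) ep.
have nl := nonlinearity_lower x tg a.
have D := congr1 (fun z => z * expR (l * x)) disp_l.
have D' := ler_wpM2r (expR_ge0 (m * x)) disp_m.
have fe : error_cst * expR ((1 + s) * l * x) <= error_cst * expR (m * x).
  by rewrite ler_wpM2l ?error_cst_ge0// ler_expR ler_wnM2r.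
have : 0 <= (k - 2 * d + a1) * (psi x - sub x).
  rewrite mulr_ge0 ?subr_ge0// /stiffness.
  by have := ler_norm (- a1); rewrite normrN; move: n0; lra.
by rewrite /sub; move: em ep nl D D' fe => /=; lra.
Qed.

(** Right of [x1] the lower barrier is zero. Left of [x1], which is nonpositive, [relax_rhs_lower]
    makes [sub] a subsolution, and [comparison] runs on that half-line without a boundary condition
    at [x1]. *)
Lemma relax_rhs_between psi x : adm psi ->
  lower x <= relax (k / c) (relax_rhs psi) x <= upper x.
Proof.
move=> a.
have b0 : 0 < k / c by rewrite divr_gt0// k_gt0.
have cH := relax_rhs_continuous a; have bH := relax_rhs_bnd a.
have [dr rb] := relax_spec b0 cH bH.
have r0 y : 0 <= relax (k / c) (relax_rhs psi) y by case/andP: (rb y).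
apply/andP; split.
  rewrite /lower ge_max r0/=.
  have [/sub_le0/le_trans|xx] := leP x1 x; first by apply.
  rewrite -subr_ge0.
  pose z y := relax (k / c) (relax_rhs psi) y - sub y.
  pose dz y := relax_rhs psi y - k / c * relax (k / c) (relax_rhs psi) y
    - (l * expR (l * y) - q * (m * expR (m * y))).
  apply: (@comparison R x1 (k / c) K z dz) => //.
  - move=> y _; apply: (is_deriveB (dr y)).
    apply: (is_deriveB (is_derive_expRM l y)).
    exact: (is_deriveZ q (is_derive_expRM m y)).
  - move=> y yx; have := relax_rhs_lower a (le_trans (ltW yx) x10).
    by rewrite /z /dz; lra.
  - by move=> y _; rewrite /z; have := sub_leK y; have := r0 y; lra.
rewrite /upper le_min; apply/andP; split.
  by have /andP[_] := rb x; rewrite mulrAC divff ?gt_eqF// mul1r.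
apply: (relax_le b0 cH bH (is_derive_expRM l)).
- by move=> y; exact: relax_rhs_upper.
- by exists 0 => y; rewrite oppr0 expR_ge0.
Qed.

Lemma minimal_wave : exists phi, [/\ adm phi,
  forall x, is_derive x (1 : R) phi (wave_rhs g phi x) &
  forall psi dpsi, adm psi -> (forall x, is_derive x (1 : R) psi (dpsi x)) ->
    (forall x, wave_rhs g psi x <= dpsi x) -> forall x, phi x <= psi x].
Proof.
have b0 : 0 < k / c by rewrite divr_gt0// k_gt0.
have l_0 x : 0 <= lower x by rewrite le_max lexx.
have E psi x : relax_rhs psi x = wave_rhs g psi x + k / c * psi x.
  by rewrite /relax_rhs /wave_rhs; ring.
have [phi [a dphi min]] := minimal_solution b0 l_0 upper_adm relax_rhs_continuous
  relax_rhs_bnd relax_rhs_incr relax_rhs_mono relax_rhs_between.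
exists phi; split => //.
- by move=> x; apply: (is_derive_eq (dphi x)); rewrite E addrK.
- move=> psi dpsi ap dp le; apply: (min _ _ ap dp) => x.
  by rewrite E lerD2r.
Qed.

End Nonlinearity.

End WaveOperator.

Lemma leq_of_sum5 (a b c d e n : nat) : (a + b + c + d + e <= n)%N ->
  [/\ (a <= n)%N, (b <= n)%N, (c <= n)%N, (d <= n)%N & (e <= n)%N].
Proof. by move=> le; split; lia. Qed.

(** * Passage to the limit in the regularised waves *)

Section LimitWave.
Set Implicit Arguments. Unset Strict Implicit. Unset Printing Implicit Defensive.
Context {R : realType}.
Variables (d tau c K a1 a2 : R) (h : R -> R).
Hypothesis d0 : 0 < d.
Hypothesis c0 : 0 < c.
Hypothesis K0 : 0 < K.
Hypothesis a20 : 0 <= a2.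
Hypothesis h0 : forall x, 0 <= h x.
Hypothesis hint : leb.-integrable setT (EFin \o h).
Hypothesis h1 : (\int[leb]_x (h x)%:E = 1%:E)%E.
Variables (l m s q M x1 : R).
Hypothesis l0 : 0 < l.
Hypothesis lm : l < m.
Hypothesis s0 : 0 < s.
Hypothesis ms : m <= (1 + s) * l.
Hypothesis M0 : 0 <= M.
Hypothesis exp_int : 0 < a2 -> exp_integrable h l /\ exp_integrable h m.
Hypothesis disp_l : c * l = d * (expR l + expR (- l) - 2) + a1 + nonlocal tau c a2 h l.
Hypothesis disp_m : error_cst tau c a2 h l s M <=
  q * (c * m - d * (expR m + expR (- m) - 2) - a1 - nonlocal tau c a2 h m).
Hypothesis x10 : x1 <= 0.
Hypothesis x1K : expR (l * x1) <= K.
Hypothesis x1q : 1 <= q * expR ((m - l) * x1).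
Local Notation adm := (admissible (lower l m q) (upper K l)).
Local Notation rhs := (wave_rhs d tau c h).
Local Notation W := (delayed tau c h).

Variables (F : R -> R -> R) (B : R).
Hypothesis FB : forall u v, `|F u v| <= B.
Hypothesis F_unif : forall e, 0 < e -> exists2 r, 0 < r & forall u u' v v',
  `|u - u'| < r -> `|v - v'| < r -> `|F u v - F u' v'| < e.
Hypothesis F_mono : forall u v v', v <= v' -> F u v <= F u v'.
Hypothesis F_tangent : tangent K a1 a2 s M F.
Hypothesis FK : F K K <= 0.

(** Exceeds the Lipschitz constant in [u] of the lower bound of (F2), since
    [u + active * v <= 2 * K]; from this index on the regularisation keeps that bound. *)
Let N0 : nat := (Num.truncn (`|a1| + M * ((1 + s) * (2 * K) `^ s))).+1.
Let gn (n : nat) := infconv K F (N0 + n).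

Let gn_lip n u1 u2 v : `|gn n u1 v - gn n u2 v| <= (N0 + n)%:R * `|u1 - u2|.
Proof.
rewrite ler_norml; have := infconv_lip (ltW K0) FB (N0 + n) u1 u2 v.
have := infconv_lip (ltW K0) FB (N0 + n) u2 u1 v; rewrite (distrC u2) /gn.
by lra.
Qed.

Let gn_tangent n : tangent K a1 a2 s M (gn n).
Proof.
move=> u v uK vK; have /andP[_ Fu] := F_tangent uK vK.
apply/andP; split; last exact: le_trans (infconv_le_self FB _ _ uK) Fu.
pose t w := w + active a2 * v.
pose ell w := a1 * w + a2 * v - M * (t w) `^ (1 + s).
apply: (infconv_minorant (ltW K0) (l := ell) uK).
  by move=> w wK; case/andP: (F_tangent wK vK).
move=> w wK.
have Nn : `|a1| + M * ((1 + s) * (2 * K) `^ s) <= (N0 + n)%:R.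
  by apply/ltW/(lt_le_trans (truncnS_gt _)); rewrite ler_nat leq_addr.
have act : 0 <= active a2 * v <= K.
  by rewrite /active; case: ifP => _; rewrite ?mul1r// mul0r lexx ltW.
have s1 : 0 <= 1 + s by rewrite addr_ge0// ltW.
have t0 z : 0 <= z <= K -> 0 <= t z <= 2 * K.
  by move: act; rewrite /t; lra.
have := ler_wpM2r (normr_ge0 (u - w)) Nn; rewrite mulrDl => Nn'.
have a1w : a1 * (u - w) <= `|a1| * `|u - w| by rewrite -normrM ler_norm.
have pw : M * (t w `^ (1 + s) - t u `^ (1 + s)) <= M * ((1 + s) * (2 * K) `^ s) * `|u - w|.
  rewrite -mulrA ler_wpM2l//; have [uw|wu] := leP u w.
    rewrite distrC ger0_norm ?subr_ge0// (_ : w - u = t w - t u); last by rewrite /t; ring.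
    have /andP[tu0 _] := t0 u uK; have /andP[_ tw1] := t0 w wK.
    by apply: powR1D_lip => //; rewrite lerD2r.
  apply: (@le_trans _ _ 0); last by rewrite !mulr_ge0 ?powR_ge0.
  have /andP[tu0 _] := t0 u uK; have /andP[tw0 _] := t0 w wK.
  by rewrite subr_le0 ge0_ler_powR ?nnegrE// lerD2r ltW.
by move: Nn' a1w pw; rewrite /ell; lra.
Qed.

Let gn_cont n e : 0 < e -> exists2 r, 0 < r & forall u v v', 0 <= u <= K ->
  `|v - v'| < r -> `|gn n u v - gn n u v'| <= e.
Proof.
move=> e0; have [r r0 hr] := F_unif e0; exists r => // u v v' _ vv.
have key w1 w2 : `|w1 - w2| < r -> gn n u w1 <= gn n u w2 + e.
  move=> ww; apply: (infconv_shift_r (ltW K0) FB) => w wK.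
  by have := hr w w w1 w2; rewrite subrr normr0 => /(_ r0 ww); rewrite ltr_norml; lra.
have := key v v' vv; rewrite distrC in vv; have := key v' v vv.
by rewrite ler_norml; lra.
Qed.

Let wave n : exists phi, [/\ adm phi,
  forall x, is_derive x (1 : R) phi (rhs (gn n) phi x) &
  forall psi dpsi, adm psi -> (forall x, is_derive x (1 : R) psi (dpsi x)) ->
    (forall x, rhs (gn n) psi x <= dpsi x) -> forall x, phi x <= psi x].
Proof.
apply: (minimal_wave d0 c0 K0 a20 h0 hint h1 l0 lm s0 ms M0 exp_int (ler0n R (N0 + n))
  (gn_tangent n) _ (gn_lip n) _ (@gn_cont n) disp_l disp_m x10 x1K x1q).
- by apply: le_trans FK; apply: (infconv_le_self FB); rewrite lexx ltW.
- move=> u v1 v2 vv; rewrite -[X in _ <= X]addr0.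
  by apply: (infconv_shift_r (ltW K0) FB) => w wK; rewrite addr0 F_mono.
Qed.

Let phi n : R -> R := sval (cid (wave n)).

Let phi_adm n : adm (phi n).
Proof. by rewrite /phi; case: cid => p /= []. Qed.

Let phi_derive n x : is_derive x (1 : R) (phi n) (rhs (gn n) (phi n) x).
Proof. by rewrite /phi; case: cid => p /= []. Qed.

Let phi_min n psi dpsi : adm psi -> (forall x, is_derive x (1 : R) psi (dpsi x)) ->
    (forall x, rhs (gn n) psi x <= dpsi x) -> forall x, phi n x <= psi x.
Proof. by rewrite /phi; case: cid => p /= [_ _]; exact. Qed.

Let phi_le_succ n x : phi n x <= phi n.+1 x.
Proof.
apply: (phi_min (phi_adm n.+1) (phi_derive n.+1)) => y.
rewrite ler_pM2r ?invr_gt0// lerD2l /gn addnS.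
exact: (infconv_le_index (ltW K0) FB).
Qed.

Let phi_nondecr x : nondecreasing_seq (phi ^~ x).
Proof. by apply/nondecreasing_seqP => n; exact: phi_le_succ. Qed.

(** Bounds the right-hand side for every [n]: [Delta1] is at most [4 * K] in size and the
    regularisation is bounded by [B]. *)
Let L : R := (4 * d * K + B) / c.

Let phi_lip n x y : `|phi n x - phi n y| <= L * `|x - y|.
Proof.
wlog xy : x y / x < y.
  move=> H; have [/H//|/H|->] := ltgtP x y; last by rewrite !subrr normr0 mulr0.
  by rewrite distrC [X in _ <= _ * X]distrC.
have [z _] := mean_value xy (fun z _ => phi_derive n z).
rewrite distrC [X in _ <= _ * X]distrC => ->; rewrite normrM ler_wpM2r//.
rewrite /wave_rhs normrM normfV (gtr0_norm c0) ler_pM2r ?invr_gt0//.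
apply: le_trans (ler_normD _ _) _; apply: lerD.
  rewrite normrM (gtr0_norm d0) (_ : 4 * d * K = d * (4 * K)); last by ring.
  rewrite ler_wpM2l ?(ltW d0)// /Delta1 ler_norml.
  have := adm_itv (phi_adm n) z; have := adm_itv (phi_adm n) (z + 1).
  by have := adm_itv (phi_adm n) (z - 1); lra.
by apply: (infconv_norm (ltW K0) FB); exact: adm_itv.
Qed.

Let Phi x : R := sup (range (phi ^~ x)).

Let phi_cvg x : phi ^~ x @ \oo --> Phi x.
Proof.
apply: nondecreasing_cvgn; first exact: phi_nondecr.
by exists K => _ [n _ <-]; case/andP: (adm_itv (phi_adm n) x).
Qed.

Let lim_le x (b : R) : (forall n, phi n x <= b) -> Phi x <= b.
Proof.
move=> le; rewrite -(cvg_lim _ (@phi_cvg x))//.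
by apply: limr_le; [exact: cvgP (@phi_cvg x)|exact: nearW].
Qed.

Let le_Phi n x : phi n x <= Phi x.
Proof.
rewrite -(cvg_lim _ (@phi_cvg x))//; apply: nondecreasing_cvgn_le => //.
exact: cvgP (@phi_cvg x).
Qed.

Let Phi_adm : adm Phi.
Proof.
split.
- move=> x y xy; apply: lim_le => n; apply: le_trans (le_Phi n y).
  by have [incr _ _] := phi_adm n; exact: incr.
- exists L => x y.
  have key u v : Phi u <= Phi v + L * `|u - v|.
    apply: lim_le => n; apply: le_trans (lerD (le_Phi n v) (lexx _)).
    by have := phi_lip n u v; rewrite ler_norml; lra.
  by have := key x y; have := key y x; rewrite (distrC y) ler_norml; lra.
- move=> x; apply/andP; split.
    apply: le_trans (le_Phi 0%N x).
    by have [_ _ /(_ x)/andP[]] := phi_adm 0%N.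
  by apply: lim_le => n; have [_ _ /(_ x)/andP[]] := phi_adm n.
Qed.

Let W_cvg x : (fun n => W (phi n) x) @ \oo --> W Phi x.
Proof.
apply: (conv_cvg h0 hint (B := K)).
- by move=> n; exact: adm_continuous (phi_adm n).
- by move=> n y; exact: adm_norm (phi_adm n) y.
- exact: adm_continuous Phi_adm.
- exact: phi_cvg.
Qed.

Let close (u : nat -> R) (a e : R) : u @ \oo --> a -> 0 < e ->
  exists N, forall n, (N <= n)%N -> `|a - u n| < e.
Proof. by move=> /cvgrPdist_lt H /H[N _ hN]; exists N. Qed.

Let L0 : 0 <= L.
Proof.
have B0 := le_trans (normr_ge0 _) (FB 0 0).
by rewrite divr_ge0 ?(ltW c0)// addr_ge0// !mulr_ge0// ltW.
Qed.

(* The right-hand sides converge continuously: jointly in n -> oo and y -> x. *)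
Let rhs_cvg x e : 0 < e -> exists N, exists2 r, 0 < r &
  forall n y, (N <= n)%N -> `|y - x| < r -> `|rhs (gn n) (phi n) y - rhs F Phi x| <= e.
Proof.
move=> e0.
have ec : 0 < e * c by rewrite mulr_gt0.
have ec2 : 0 < e * c / 4 by rewrite divr_gt0.
have [r r0 hr] := F_unif ec2.
have [N1 hN1] := infconv_unif (ltW K0) FB (F_unif ec2) ec2.
(* The error budget is [e * c]: a quarter for the four profile values in the discrete Laplacian, a
   quarter for continuity of [F], and a quarter for replacing [F] by its regularisation. *)
pose e1 := Num.min (r / 2) (e * c / (32 * d)).
have e10 : 0 < e1 by rewrite lt_min !divr_gt0// mulr_gt0.
have [N2 hN2] := close (@phi_cvg x) e10.
have [N3 hN3] := close (@phi_cvg (x + 1)) e10.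
have [N4 hN4] := close (@phi_cvg (x - 1)) e10.
have [N5 hN5] := close (@W_cvg x) e10.
have L1 : 0 < L + 1 by rewrite ltr_wpDl.
exists (N1 + N2 + N3 + N4 + N5)%N; exists (e1 / (L + 1)); first by rewrite divr_gt0.
move=> n y Nn yx.
have [n1 n2 n3 n4 n5] : [/\ (N1 <= n)%N, (N2 <= n)%N, (N3 <= n)%N, (N4 <= n)%N & (N5 <= n)%N].
  exact: leq_of_sum5.
have yL : L * `|y - x| < e1.
  move: yx; rewrite ltr_pdivlMr// mulrC; apply: le_lt_trans.
  by rewrite ler_wpM2r// lerDl.
have near z z' : `|Phi z - phi n z| < e1 -> z' - z = y - x -> `|phi n z' - Phi z| < 2 * e1.
  move=> zz zy; have := phi_lip n z' z; rewrite zy => /le_lt_trans/(_ yL).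
  have := ler_distD (phi n z) (phi n z') (Phi z); rewrite (distrC (phi n z) (Phi z)).
  by move: zz; lra.
have u0 : `|phi n y - Phi x| < 2 * e1 by apply: near => //; exact: hN2.
have u1 : `|phi n (y + 1) - Phi (x + 1)| < 2 * e1.
  by apply: near; [exact: hN3|ring].
have u2 : `|phi n (y - 1) - Phi (x - 1)| < 2 * e1.
  by apply: near; [exact: hN4|ring].
have w : `|W (phi n) y - W Phi x| < 2 * e1.
  have := delayed_lip tau c h0 hint h1 (phi_adm n) (phi_lip n) y x => /le_lt_trans/(_ yL).
  have := ler_distD (W (phi n) x) (W (phi n) y) (W Phi x); rewrite (distrC (W (phi n) x) (W Phi x)).
  by have := hN5 n n5; lra.
have e1r : 2 * e1 <= r.
  by rewrite mulrC -ler_pdivlMr// /e1 ge_min lexx.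
have e1d : d * (2 * e1) <= e * c / 16.
  have : e1 <= e * c / (32 * d) by rewrite /e1 ge_min lexx orbT.
  move=> /(ler_wpM2l (ltW d0)).
  have -> : d * (e * c / (32 * d)) = e * c / 32 by field; rewrite gt_eqF.
  by lra.
have f1 := hr _ _ _ _ (lt_le_trans u0 e1r) (lt_le_trans w e1r).
have itv := adm_itv (phi_adm n) y.
have f2 : F (phi n y) (W (phi n) y) - e * c / 4 <= gn n (phi n y) (W (phi n) y).
  by apply: hN1 => //; exact: leq_trans n1 (leq_addl _ _).
have f3 : gn n (phi n y) (W (phi n) y) <= F (phi n y) (W (phi n) y).
  exact: (infconv_le_self FB).
have scale z : `|z| < 2 * e1 -> - (e * c / 16) <= d * z <= e * c / 16.
  move=> zz; rewrite -ler_norml normrM (gtr0_norm d0); apply: le_trans e1d.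
  by rewrite ler_wpM2l// ltW.
have d1 := scale _ u0; have d2 := scale _ u1; have d3 := scale _ u2.
rewrite /wave_rhs -mulrBl normrM normfV (gtr0_norm c0) ler_pdivrMr//.
rewrite ler_norml; move: f1; rewrite ltr_norml /Delta1.
by move: d1 d2 d3 f2 f3; rewrite !mulrBr; lra.
Qed.

(** The mean value theorem for [phi n] turns [rhs_cvg] into a difference-quotient estimate uniform
    in [n], through which pointwise limits pass. *)
Lemma limit_wave : exists Phi, adm Phi /\ forall x, is_derive x (1 : R) Phi (rhs F Phi x).
Proof.
exists Phi; split; first exact: Phi_adm.
move=> x; apply: is_derive_dist => e e0.
have [N [r r0 hr]] := rhs_cvg x e0; exists r => // y yx.
have key n : (N <= n)%N -> `|phi n y - phi n x - rhs F Phi x * (y - x)| <= e * `|y - x|.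
  move=> Nn.
  suff [z zr ->] : exists2 z, `|z - x| < r & phi n y - phi n x = rhs (gn n) (phi n) z * (y - x).
    by rewrite -mulrBl normrM ler_wpM2r// hr.
  move: yx; have [xy|yx|->] := ltgtP x y => yr.
  - have [z /andP[xz zy] ->] := mean_value xy (fun z _ => phi_derive n z).
    exists z => //; move: yr; rewrite !gtr0_norm ?subr_gt0//; apply: lt_trans.
    by rewrite ltrD2r.
  - have [z /andP[xz zy] E] := mean_value yx (fun z _ => phi_derive n z).
    exists z; last by rewrite -opprB E -mulrN opprB.
    move: yr; rewrite distrC (distrC z) !gtr0_norm ?subr_gt0//; apply: lt_trans.
    by rewrite ltrD2l ltrN2.
  - by exists y; rewrite ?subrr ?normr0// mulr0.
have cv : (fun n => `|phi n y - phi n x - rhs F Phi x * (y - x)|) @ \oo -->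
    `|Phi y - Phi x - rhs F Phi x * (y - x)|.
  by apply: cvg_norm; apply: cvgB; [apply: cvgB; exact: phi_cvg|exact: cvg_cst].
rewrite -(cvg_lim _ cv)//; apply: limr_le; first exact: cvgP cv.
by exists N => // n; exact: key.
Qed.

End LimitWave.

Lemma expRM_cvgNy {R : realType} (p : R) : 0 < p -> expR (p * x) @[x --> -oo] --> (0 : R).
Proof.
move=> p0; apply/cvgrPdist_lt => e e0; near=> x.
rewrite sub0r normrN ger0_norm ?expR_ge0// -[X in _ < X]lnK ?posrE// ltr_expR.
by rewrite mulrC -ltr_pdivlMr//; near: x; apply: nbhs_ninfty_lt; rewrite num_real.
Unshelve. all: by end_near. Qed.

(** * Strict monotonicity, limits and asymptotics of the wave *)

Section WaveProperties.
Set Implicit Arguments. Unset Strict Implicit. Unset Printing Implicit Defensive.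
Context {R : realType}.
Variables (d tau c K a1 a2 : R) (h : R -> R).
Hypothesis d0 : 0 < d.
Hypothesis c0 : 0 < c.
Hypothesis K0 : 0 < K.
Hypothesis a20 : 0 <= a2.
Hypothesis h0 : forall x, 0 <= h x.
Hypothesis hint : leb.-integrable setT (EFin \o h).
Hypothesis h1 : (\int[leb]_x (h x)%:E = 1%:E)%E.
Variables (l m s q M : R).
Hypothesis l0 : 0 < l.
Hypothesis lm : l < m.
Hypothesis s0 : 0 < s.
Hypothesis M0 : 0 <= M.
Hypothesis q0 : 0 < q.
Hypothesis exp_int : 0 < a2 -> exp_integrable h l /\ exp_integrable h m.
Hypothesis disp_l : c * l = d * (expR l + expR (- l) - 2) + a1 + nonlocal tau c a2 h l.
Local Notation W := (delayed tau c h).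

Variables (F : R -> R -> R).
Local Notation rhs := (wave_rhs d tau c h F).
Hypothesis F_unif : forall e, 0 < e -> exists2 r, 0 < r & forall u u' v v',
  `|u - u'| < r -> `|v - v'| < r -> `|F u v - F u' v'| < e.
Hypothesis F_mono : forall u v v', v <= v' -> F u v <= F u v'.
Hypothesis F_tangent : tangent K a1 a2 s M F.
Hypothesis F_lip_at : forall u v, 0 <= u <= K -> 0 <= v <= K ->
  exists2 C, 0 <= C & forall w, 0 <= w <= K -> `|F w v - F u v| <= C * `|w - u|.
Hypothesis F_diag : forall u, 0 < u < K -> 0 < F u u.

Variable phi : R -> R.
Hypothesis phi_adm : admissible (lower l m q) (upper K l) phi.
Hypothesis phi_derive : forall x, is_derive x (1 : R) phi (rhs phi x).

Lemma phi_le x y : x <= y -> phi x <= phi y.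
Proof. by have [incr _ _] := phi_adm; exact: incr. Qed.

Lemma phi_gt0 x : 0 < phi x.
Proof.
have ml : 0 < m - l by rewrite subr_gt0.
(* Here [q * exp ((m - l) y) <= exp (-1)], so the subsolution is positive at [y]; monotonicity
   carries this to [x]. *)
pose y := Num.min x (- (ln q + 1) / (m - l)).
apply: lt_le_trans (_ : phi y <= _); last by apply: phi_le; rewrite ge_min lexx.
apply: lt_le_trans (adm_sub phi_adm y).
rewrite /sub (_ : m * y = l * y + (m - l) * y); last by ring.
rewrite expRD -[X in X - _]mulr1 mulrCA -mulrBr mulr_gt0 ?expR_gt0// subr_gt0.
rewrite -{1}(lnK (_ : q \in Num.pos)) ?posrE// -expRD -[X in _ < X]expR0 ltr_expR.
have : y <= - (ln q + 1) / (m - l) by rewrite ge_min lexx orbT.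
by rewrite ler_pdivlMr// mulrC; lra.
Qed.

Lemma phi_cvgNy : phi x @[x --> -oo] --> (0 : R).
Proof.
have H : \forall x \near -oo, cst 0 x <= phi x <= expR (l * x).
  by apply: nearW => x; rewrite (ltW (phi_gt0 x)) (adm_exp phi_adm).
by apply: (squeeze_cvgr H); [exact: cvg_cst|exact: expRM_cvgNy].
Qed.

(* At a zero of [phi'], Gronwall's inequality to the left would make [phi]
   constant on a half-line. *)
Lemma rhs_gt0 x : 0 < rhs phi x.
Proof.
rewrite ltNge; apply/negP => rx.
have [C C0 hC] := F_lip_at (adm_itv phi_adm x) (delayed_itv tau c h0 hint h1 x phi_adm).
(* Left of [x] the shifted and delayed terms are no larger than at [x]; only [-2 * d * phi] and the
   first argument of [F] can raise the right-hand side, by at most these two constants. *)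
pose C' := (2 * d + C) / c.
have rhs_le y : y <= x -> rhs phi y <= C' * (phi x - phi y).
  move=> yx; rewrite /C' mulrAC ler_pdivlMr//.
  have crx : rhs phi x * c <= 0 by rewrite pmulr_lle0.
  have cE z : rhs phi z * c = d * Delta1 phi z + F (phi z) (W phi z).
    by rewrite /wave_rhs -mulrA mulVf ?gt_eqF// mulr1.
  have p1 : phi (y + 1) <= phi (x + 1) by apply: phi_le; rewrite lerD2r.
  have p2 : phi (y - 1) <= phi (x - 1) by apply: phi_le; rewrite lerD2r.
  have p3 := phi_le yx.
  have w := delayed_incr tau c h0 hint phi_adm yx.
  have Fw := F_mono (phi y) w.
  have := hC _ (adm_itv phi_adm y).
  rewrite (distrC (phi y)) [X in C * X]ger0_norm ?subr_ge0// ler_norml => /andP[_].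
  have := ler_wpM2l (ltW d0) p1; have := ler_wpM2l (ltW d0) p2.
  move: crx; rewrite !cE /Delta1; lra.
(* By [rhs_le] the function [(phi x - phi t) * exp (C' t)] is nondecreasing left of [x], and it
   vanishes at [x]. *)
have flat y : y < x -> phi x <= phi y.
  move=> yx.
  have dz t : is_derive t (1 : R) (fun t => phi x - phi t) (- rhs phi t).
    by apply: (is_derive_eq (is_deriveB (is_derive_cst (phi x) t 1) (phi_derive t))); rewrite sub0r.
  have [t /andP[yt tx]] := mean_value yx (fun t _ => integrating_factor C' (dz t)).
  have : 0 <= (- rhs phi t + C' * (phi x - phi t)) * expR (C' * t) * (x - y).
    rewrite !mulr_ge0 ?expR_ge0 ?subr_ge0 ?(ltW yx)//.
    by rewrite addrC subr_ge0 rhs_le// ltW.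
  move=> /[swap] <-; rewrite subrr mul0r sub0r oppr_ge0 pmulr_lle0 ?expR_gt0//.
  by rewrite subr_le0.
pose y := Num.min (x - 1) (ln (phi x / 2) / l).
have px := phi_gt0 x.
have yx : y < x by rewrite gt_min ltrBlDr ltrDl ltr01.
have : phi x <= expR (l * y) by apply: le_trans (flat y yx) _; exact: adm_exp phi_adm y.
have : expR (l * y) <= phi x / 2.
  rewrite -[X in _ <= X]lnK ?posrE ?divr_gt0// ler_expR mulrC -ler_pdivlMr//.
  by rewrite ge_min lexx orbT.
by lra.
Qed.

Lemma phi_lt x y : x < y -> phi x < phi y.
Proof.
move=> xy; have [z _] := mean_value xy (fun z _ => phi_derive z).
by rewrite -subr_gt0 => ->; rewrite mulr_gt0 ?subr_gt0// rhs_gt0.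
Qed.

Lemma phi_ltK x : phi x < K.
Proof.
apply: lt_le_trans (_ : phi (x + 1) <= K); first by apply: phi_lt; rewrite ltrDl.
by case/andP: (adm_itv phi_adm (x + 1)).
Qed.

Let S : R := sup (range phi).

Let phi_leS x : phi x <= S.
Proof.
apply: ub_le_sup; last by exists x.
by exists K => _ [y _ <-]; exact: ltW (phi_ltK y).
Qed.

Let phi_nearS e : 0 < e -> exists N, forall x, N <= x -> S - e < phi x.
Proof.
move=> e0; have hs : has_sup (range phi).
  by split; [exists (phi 0), 0|exists K => _ [y _ <-]; exact: ltW (phi_ltK y)].
have [_ [N _ <-] hN] := sup_adherent e0 hs.
by exists N => x Nx; apply: lt_le_trans hN (phi_le Nx).
Qed.

Let delayed_leS x : W phi x <= S.
Proof.
rewrite -(@conv_cst _ h hint h1 S (x - c * tau)) /delayed.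
apply: (@conv_le _ _ h0 hint K `|S| _ _ _ (adm_continuous phi_adm) (adm_norm phi_adm)) => //.
exact: cst_continuous.
Qed.

(** The translates of [phi] by [n] tend pointwise to the constant [S], and the convolution of a
    constant is that constant; monotonicity extends the bound from one point to a half-line. *)
Let delayed_nearS e : 0 < e -> exists N, forall x, N <= x -> S - e < W phi x.
Proof.
move=> e0.
pose psi (n : nat) y := phi (y + n%:R).
have cv : (fun n => conv h (psi n) (0 - c * tau)) @ \oo --> conv h (fun=> S) (0 - c * tau).
  apply: (conv_cvg h0 hint (B := K)).
  - move=> n; rewrite /psi => y; apply: (@continuous_comp _ _ _ (fun z : R => z + n%:R) phi).
      by apply: cvgD; [exact: cvg_id|exact: cvg_cst].
    exact: adm_continuous phi_adm _.
  - by move=> n y; exact: adm_norm phi_adm _.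
  - exact: cst_continuous.
  - move=> y; apply/cvgrPdist_lt => e' e'0; have [N hN] := phi_nearS e'0.
    exists (Num.truncn (N - y)).+1 => // n /= Nn.
    rewrite ger0_norm ?subr_ge0 ?phi_leS// ltrBlDr -ltrBlDl; apply: hN.
    rewrite -lerBlDl; apply/ltW/(lt_le_trans (truncnS_gt _)).
    by rewrite ler_nat.
move/cvgrPdist_lt: cv => /(_ e e0)[n _ /(_ n (leqnn n))].
rewrite conv_cst// /psi conv_shift (_ : 0 - c * tau + n%:R = n%:R - c * tau); last by ring.
move=> hn; exists n%:R => x nx.
have := delayed_incr tau c h0 hint phi_adm nx; rewrite /delayed.
by move: hn; rewrite ltr_norml; lra.
Qed.

Lemma sup_phi : S = K.
Proof.
have SK : S <= K.
  by apply: ge_sup; [exists (phi 0), 0|move=> _ [y _ <-]; exact: ltW (phi_ltK y)].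
apply/eqP; rewrite eq_le SK leNgt; apply/negP => SltK.
have FS : 0 < F S S by rewrite F_diag// SltK (lt_le_trans (phi_gt0 0) (phi_leS 0)).
have FS4 : 0 < F S S / 4 by rewrite divr_gt0.
have [r r0 hr] := F_unif FS4.
(* At a mean value point [z] far to the right, [c * phi'(z)] would be at most [F S S / 4], while the
   equation makes it more than [3/4 * F S S - 4 * d * e], hence more than [F S S / 2]. *)
pose e := Num.min r (Num.min (F S S / (16 * d)) (F S S / (4 * c))).
have e0 : 0 < e by rewrite !lt_min r0 !divr_gt0// mulr_gt0.
have er : e <= r by rewrite ge_min lexx.
have ed : d * e <= F S S / 16.
  rewrite mulrC -ler_pdivlMr//; apply: le_trans (_ : F S S / (16 * d) <= _).
    by rewrite !ge_min lexx !orbT.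
  by rewrite invfM mulrA.
have ec : c * e <= F S S / 4.
  rewrite mulrC -ler_pdivlMr//; apply: le_trans (_ : F S S / (4 * c) <= _).
    by rewrite !ge_min lexx !orbT.
  by rewrite invfM mulrA.
have [N1 hN1] := phi_nearS e0; have [N2 hN2] := delayed_nearS e0.
(* The extra unit covers the argument [z - 1]. *)
pose N := Num.max (N1 + 1) N2.
have NN1 : N1 + 1 <= N by rewrite le_max lexx.
have NN2 : N2 <= N by rewrite le_max lexx orbT.
have [|z /andP[Nz zN]] := mean_value (_ : N < N + 1) (fun z _ => phi_derive z).
  by rewrite ltrDl.
have -> : N + 1 - N = 1 by ring.
rewrite mulr1 => E.
have crz : rhs phi z * c = d * Delta1 phi z + F (phi z) (W phi z).
  by rewrite /wave_rhs -mulrA mulVf ?gt_eqF// mulr1.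
have near x : N1 <= x -> S - e < phi x <= S by move=> /hN1 ->; rewrite phi_leS.
have b0 : S - e < phi z <= S by apply: near; lra.
have b1 : S - e < phi (z + 1) <= S by apply: near; lra.
have b2 : S - e < phi (z - 1) <= S by apply: near; lra.
have b3 : S - e < phi N <= S by apply: near; lra.
have b4 := phi_leS (N + 1).
have w1 : S - e < W phi z by apply: hN2; lra.
have w2 := delayed_leS z.
have u : `|phi z - S| < r by move: b0; rewrite ltr_norml; lra.
have w : `|W phi z - S| < r by move: w1 w2; rewrite ltr_norml; lra.
have := hr _ _ _ _ u w; rewrite ltr_norml => /andP[Fz _].
have D1 : - (4 * (d * e)) <= d * Delta1 phi z.
  have -> : - (4 * (d * e)) = d * (- (4 * e)) by ring.
  by rewrite ler_wpM2l ?(ltW d0)// /Delta1; lra.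
have cE : rhs phi z * c <= c * e by rewrite mulrC ler_wpM2l ?(ltW c0)// -E; lra.
by move: cE; rewrite crz; lra.
Qed.

Lemma phi_cvgy : phi x @[x --> +oo] --> K.
Proof.
apply/cvgrPdist_lt => e e0; rewrite -sup_phi; have [N hN] := phi_nearS e0.
near=> x; rewrite ger0_norm ?subr_ge0 ?phi_leS// ltrBlDr -ltrBlDl; apply: hN.
by near: x; apply: nbhs_pinfty_ge; rewrite num_real.
Unshelve. all: by end_near. Qed.

(** Both barriers after division by [exp (l x)]; the values [t = 0, 1, -1] are those occurring in
    the equation. *)
Lemma phi_scaled (x t : R) :
  expR (l * t) - q * (expR (m * t) * expR ((m - l) * x))
    <= phi (x + t) * expR (- l * x) <= expR (l * t).
Proof.
have -> : expR (l * t) = expR (l * (x + t)) * expR (- l * x) by rewrite -expRD; congr expR; ring.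
have -> : expR (m * t) * expR ((m - l) * x) = expR (m * (x + t)) * expR (- l * x).
  by rewrite -!expRD; congr expR; ring.
rewrite mulrA -mulrBl !ler_wpM2r ?expR_ge0 ?(adm_exp phi_adm)//.
exact: (adm_sub phi_adm).
Qed.

Lemma phi_asymptotic : phi x * expR (- l * x) @[x --> -oo] --> (1 : R).
Proof.
have ml : 0 < m - l by rewrite subr_gt0.
have lo : 1 - q * expR ((m - l) * x) @[x --> -oo] --> (1 : R).
  rewrite -[X in _ --> X]subr0 -[X in _ --> _ - X](mulr0 q); apply: cvgB; first exact: cvg_cst.
  by apply: cvgM; [exact: cvg_cst|exact: expRM_cvgNy].
have H : \forall x \near -oo, 1 - q * expR ((m - l) * x) <= phi x * expR (- l * x) <= cst 1 x.
  by apply: nearW => x; have := phi_scaled x 0; rewrite !mulr0 expR0 mul1r addr0.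
by apply: (squeeze_cvgr H) => //; exact: cvg_cst.
Qed.

Lemma rhs_asymptotic : rhs phi x * expR (- l * x) @[x --> -oo] --> l.
Proof.
have ml : 0 < m - l by rewrite subr_gt0.
pose Nm := nonlocal tau c a2 h m.
pose C := error_cst tau c a2 h l s M.
(* Collects the effect of [q * exp (m x)] on the discrete Laplacian, the local and the nonlocal
   linear terms; the (F2) error is the separate term in [C]. Without errors the terms sum to [c * l]
   by [disp_l]. *)
pose A := (d * q * (expR m + expR (- m) + 2) + q * `|a1| + q * `|Nm|) / c.
have lim0 : A * expR ((m - l) * x) + C / c * expR (s * l * x) @[x --> -oo] --> (0 : R).
  rewrite -[X in _ --> X](addr0) -{1}[X in _ --> X + _](mulr0 A) -[X in _ --> _ + X](mulr0 (C / c)).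
  apply: cvgD; apply: cvgM; try exact: cvg_cst; apply: expRM_cvgNy => //.
  exact: mulr_gt0.
have bound x : `|rhs phi x * expR (- l * x) - l| <= A * expR ((m - l) * x) + C / c * expR (s * l * x).
  set E := expR ((m - l) * x); set E2 := expR (s * l * x).
  have := phi_scaled x 0; have := phi_scaled x 1; have := phi_scaled x (-1).
  rewrite !mulr0 expR0 mul1r addr0 !mulr1 !mulrN1 -/E.
  move=> /andP[m1 m2] /andP[p1 p2] /andP[u1 u2].
  have e0 := expR_ge0 (- l * x).
  have := ler_wpM2r e0 (nonlinearity_upper tau c a20 h0 hint h1 exp_int x F_tangent phi_adm).
  have := ler_wpM2r e0 (nonlinearity_lower tau c a20 h0 hint h1 s0 M0 exp_int x F_tangent phi_adm).
  have e1 : expR (l * x) * expR (- l * x) = 1 by rewrite -expRD mulNr subrr expR0.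
  have e2 : expR (m * x) * expR (- l * x) = E by rewrite -expRD; congr expR; ring.
  have e3 : expR ((1 + s) * l * x) * expR (- l * x) = E2 by rewrite -expRD; congr expR; ring.
  have X1 (A1 A2 A3 A4 A5 A6 A7 A8 z : R) : (A1 * A2 + A3 * A4 - q * (A5 * A6) - A7 * A8) * z =
    A1 * (A2 * z) + A3 * (A4 * z) - q * (A5 * (A6 * z)) - A7 * (A8 * z) by ring.
  have X2 (A1 A2 A3 A4 z : R) : (A1 * A2 + A3 * A4) * z = A1 * (A2 * z) + A3 * (A4 * z) by ring.
  rewrite -/Nm -/C X1 X2 e1 e2 e3 mulr1 => F1 F2.
  have aA : `|a1 * (phi x * expR (- l * x)) - a1| <= q * `|a1| * E.
    rewrite -[X in _ - X]mulr1 -mulrBr normrM mulrC mulrAC ler_wpM2r//.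
    by rewrite distrC ger0_norm; lra.
  have nE : Nm * E <= `|Nm| * E by rewrite ler_wpM2r ?expR_ge0// ler_norm.
  have := ler_wpM2l (ltW q0) nE => nE'.
  have E0 : 0 <= E := expR_ge0 _.
  have E20 : 0 <= C * E2 by rewrite mulr_ge0 ?expR_ge0// error_cst_ge0.
  have cN : c != 0 by rewrite gt_eqF.
  have -> : rhs phi x * expR (- l * x) - l = (d * (phi (x + 1) * expR (- l * x)
     - 2 * (phi x * expR (- l * x)) + phi (x - 1) * expR (- l * x))
     + F (phi x) (W phi x) * expR (- l * x) - c * l) / c.
    by rewrite /wave_rhs /Delta1; field.
  have -> : A * E + C / c * E2 = ((d * q * (expR m + expR (- m) + 2) + q * `|a1| + q * `|Nm|) * E + C * E2) / c.
    by rewrite /A; field.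
  rewrite normrM normfV (gtr0_norm c0) ler_pM2r ?invr_gt0// disp_l.
  have := ler_wpM2l (ltW d0) m1; have := ler_wpM2l (ltW d0) m2.
  have := ler_wpM2l (ltW d0) p1; have := ler_wpM2l (ltW d0) p2.
  have := ler_wpM2l (ltW d0) u1; have := ler_wpM2l (ltW d0) u2.
  have q1 : 0 <= d * q * expR m * E by rewrite !mulr_ge0 ?expR_ge0// ltW.
  have q2 : 0 <= d * q * expR (- m) * E by rewrite !mulr_ge0 ?expR_ge0// ltW.
  have q3 : 0 <= d * q * E by rewrite !mulr_ge0// ltW.
  have q4 : 0 <= q * (`|Nm| * E) by rewrite !mulr_ge0// ltW.
  move: aA nE' F1 F2 E20 q1 q2 q3 q4; rewrite !ler_norml; lra.
apply/cvgrPdist_lt => e e0.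
move/cvgrPdist_lt: lim0 => /(_ e e0); apply: filterS => x.
rewrite sub0r normrN distrC => /(le_lt_trans (ler_norm _)); apply: le_lt_trans.
exact: bound.
Qed.

End WaveProperties.

(** * Exponential moments of [h] and concavity of the dispersion function *)

Section Dispersion.
Set Implicit Arguments. Unset Strict Implicit. Unset Printing Implicit Defensive.
Context {R : realType}.

Lemma even_exp_integrable (h : R -> R) (lam0 : \bar R) (l : R) :
  (forall x, 0 <= h x) -> (forall x, h (- x) = h x) ->
  leb.-integrable setT (EFin \o h) ->
  (forall lam : R, (lam%:E < lam0)%E ->
     (\int[leb]_(x in [set x : R | (0 <= x)%R]) (h x * expR (lam * x))%:E < +oo)%E) ->
  (`|l|%:E < lam0)%E -> exp_integrable h l.
Proof.
move=> h0 even hint fin llam.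
have mh := kernel_measurable hint.
have me (a b : R) : measurable_fun setT (fun x : R => expR (a * `|x| + b * x)).
  apply: continuous_measurable_fun => x.
  apply: (@continuous_comp _ _ _ (fun x : R => a * `|x| + b * x) expR); last exact: continuous_expR.
  apply: cvgD; apply: cvgM; [exact: cvg_cst| |exact: cvg_cst|exact: cvg_id].
  exact: (@norm_continuous _ R^o).
(* An even majorant for both signs of [l]: its two half-line integrals agree, and the right one is
   controlled by (H2). *)
pose w (x : R) := h x * expR (`|l| * `|x| + 0 * x).
have mw : measurable_fun setT w by apply: measurable_funM => //; exact: me.
have mwE : measurable_fun setT (EFin \o w) by apply/measurable_EFinP.
have w0 x : (0 <= (EFin \o w) x)%E by rewrite lee_fin mulr_ge0 ?expR_ge0.
have wN x : w (- x) = w x by rewrite /w even normrN !mul0r.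
have half : (\int[leb]_(x in `[0%R, +oo[) (EFin \o w) x < +oo)%E.
  rewrite [ltLHS](_ : _ = \int[leb]_(x in [set x : R | (0 <= x)%R]) (h x * expR (`|l| * x))%:E)%E.
    exact: fin.
  rewrite set_itvcy; apply: eq_integral => x; rewrite inE/= => x0.
  by rewrite /w mul0r addr0 (ger0_norm x0).
have half' : (\int[leb]_(x in `]-oo, 0%R]) (EFin \o w) x < +oo)%E.
  rewrite [ltLHS](_ : _ = \int[leb]_(x in `[0%R, +oo[) (EFin \o w) x)%E//.
  by rewrite ge0_integration_by_substitution0//; apply: eq_integral => x _ /=; rewrite wN.
have iw : leb.-integrable setT (EFin \o w).
  apply/integrableP; split => //.
  rewrite [ltLHS](_ : _ = \int[leb]_x (EFin \o w) x)%E; last first.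
    by apply: eq_integral => x _ /=; rewrite ger0_norm// -lee_fin; exact: w0.
  rewrite (_ : setT = `]-oo, 0%R]%classic `|` `]0%R, +oo[%classic); last first.
    apply/seteqP; split => // x _ /=; rewrite !in_itv/= andbT.
    by have [x0|x0] := leP x 0; [left|right].
  rewrite ge0_integral_setU//=; last 3 first.
  - exact: measurable_funS mwE.
  - by move=> x _; exact: w0.
  - apply/disj_setPS => x /=; rewrite !in_itv/= andbT => -[x0 x0'].
    by move: x0'; rewrite ltNge x0.
  apply: lte_add_pinfty => //; apply: le_lt_trans half.
  apply: ge0_subset_integral => //; first exact: measurable_funS mwE.
    by move=> x _; exact: w0.
  by move=> x /=; rewrite !in_itv/= !andbT => /ltW.
apply: (@le_integrable _ _ R leb _ _ _ (EFin \o w)) => //.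
- apply/measurable_EFinP; apply: measurable_funM => //.
  rewrite (_ : (fun _ => _) = (fun x : R => expR (0 * `|x| + - l * x))); first exact: me.
  by apply/funext => x; rewrite mul0r add0r.
- move=> x _ /=; rewrite lee_fin !ger0_norm ?mulr_ge0 ?expR_ge0//.
  by rewrite ler_wpM2l// ler_expR mul0r addr0 -normrM -normrN -mulNr ler_norm.
Qed.

Lemma expR_convex (a b t : R) : 0 <= t <= 1 ->
  expR (t * a + (1 - t) * b) <= t * expR a + (1 - t) * expR b.
Proof.
have tangent_le (z x : R) : expR z * (1 + (x - z)) <= expR x.
  have -> : expR x = expR z * expR (x - z) by rewrite -expRD; congr expR; ring.
  by rewrite ler_wpM2l ?expR_ge0// expR_ge1Dx.
move=> /andP[t0 t1]; set z := t * a + (1 - t) * b.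
have ha := ler_wpM2l t0 (tangent_le z a).
have t1' : 0 <= 1 - t by lra.
have hb := ler_wpM2l t1' (tangent_le z b).
apply: le_trans (lerD ha hb); rewrite le_eqVlt; apply/orP; left; apply/eqP.
by rewrite /z; ring.
Qed.

Variables (h : R -> R).
Hypothesis h0 : forall x, 0 <= h x.

(** Moving the delay factor under the integral leaves the exponential of a function linear in the
    exponent parameter, which is convex for each [y]. *)
Lemma nonlocal_convex (tau c a2 p r t : R) : 0 <= a2 -> 0 <= t <= 1 ->
  (0 < a2 -> [/\ exp_integrable h p, exp_integrable h r & exp_integrable h (t * p + (1 - t) * r)]) ->
  nonlocal tau c a2 h (t * p + (1 - t) * r) <=
    t * nonlocal tau c a2 h p + (1 - t) * nonlocal tau c a2 h r.
Proof.
move=> a20 t01 iE; rewrite /nonlocal; set z := t * p + (1 - t) * r.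
have [->|a2p] := a2_cases a20; first by rewrite !mul0r !mulr0 addr0.
have [ip ir iz] := iE a2p.
rewrite ![_ * (a2 * _)]mulrCA -mulrDr ler_wpM2l//.
have GE u : exp_integrable h u -> expR (- u * c * tau) * Gfun h u =
    \int[leb]_y (expR (- u * c * tau) * (h y * expR (- u * y))).
  by move=> iu; rewrite RintegralZl.
have iG k u : exp_integrable h u ->
    leb.-integrable setT (EFin \o (fun y => k * (expR (- u * c * tau) * (h y * expR (- u * y))))).
  move=> iu; have hh := integrableZl measurableT (expR (- u * c * tau)) iu.
  by have hh' := integrableZl measurableT k hh; exact: hh'.
have iG1 u : exp_integrable h u ->
    leb.-integrable setT (EFin \o (fun y => expR (- u * c * tau) * (h y * expR (- u * y)))).
  by move=> iu; have hh := integrableZl measurableT (expR (- u * c * tau)) iu; exact: hh.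
rewrite !GE// -!RintegralZl//; try exact: iG1.
rewrite -RintegralD//; try exact: iG.
apply: le_Rintegral => //; first exact: iG1.
  by have hh := integrableD measurableT (iG t _ ip) (iG (1 - t) _ ir); exact: hh.
move=> y _; rewrite mulrCA -expRD.
have E u : expR (- u * c * tau) * (h y * expR (- u * y)) = h y * expR (- u * c * tau + - u * y).
  by rewrite mulrCA -expRD.
rewrite !E ![_ * (h y * _)]mulrCA -mulrDr ler_wpM2l//.
rewrite (_ : - z * c * tau + - z * y = t * (- p * c * tau + - p * y) + (1 - t) * (- r * c * tau + - r * y)).
  exact: expR_convex.
by rewrite /z; ring.
Qed.

Lemma Delta_concave (d tau a1 a2 c p r t : R) : 0 <= d -> 0 <= a2 -> 0 <= t <= 1 ->
  (0 < a2 -> [/\ exp_integrable h p, exp_integrable h r & exp_integrable h (t * p + (1 - t) * r)]) ->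
  t * Delta d tau a1 a2 h c p + (1 - t) * Delta d tau a1 a2 h c r <=
    Delta d tau a1 a2 h c (t * p + (1 - t) * r).
Proof.
move=> d0 a20 t01 iE; have := nonlocal_convex tau c a20 t01 iE.
have := ler_wpM2l d0 (expR_convex p r t01).
have := ler_wpM2l d0 (expR_convex (- p) (- r) t01).
have -> : t * - p + (1 - t) * - r = - (t * p + (1 - t) * r) by ring.
have DE u : Delta d tau a1 a2 h c u =
    c * u - (d * expR u + d * expR (- u) - d * 2) - a1 - nonlocal tau c a2 h u.
  by rewrite /Delta /nonlocal; ring.
by rewrite !DE; move=> *; lra.
Qed.

(** Only the three-point form of concavity is used, in place of continuity. The point [a < 0] leaves
    room to the left of the infimum [l] while [l = 0] is not yet excluded. *)
Lemma concave_first_zero (g : R -> R) (a b : R) : a < 0 -> 0 < b ->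
  (forall x y t, a <= x <= b -> a <= y <= b -> 0 <= t <= 1 ->
    t * g x + (1 - t) * g y <= g (t * x + (1 - t) * y)) ->
  g 0 < 0 -> 0 < g b ->
  exists l, [/\ 0 < l, l < b, g l = 0, forall x, 0 < x < l -> g x < 0 &
    forall x, l < x <= b -> 0 < g x].
Proof.
move=> a0 b0 conc g0 gb.
have three x y z : a <= x -> x < y -> y <= z -> z <= b ->
    (z - y) * g x + (y - x) * g z <= (z - x) * g y.
  move=> ax xy yz zb; have zx : 0 < z - x by lra.
  have zx0 : z - x != 0 by rewrite gt_eqF.
  pose t := (z - y) / (z - x).
  have t01 : 0 <= t <= 1.
    rewrite /t ler_pdivrMr// mul1r lerD2l lerN2 (ltW xy) andbT.
    by rewrite divr_ge0 ?subr_ge0// ltW// (lt_le_trans xy).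
  have E : t * x + (1 - t) * z = y by rewrite /t; field.
  have H : t * g x + (1 - t) * g z <= g y.
    by rewrite -E; apply: conc => //; apply/andP; split; lra.
  have := ler_wpM2l (ltW zx) H; congr (_ <= _).
  by rewrite /t; field.
pose A := [set x | 0 <= x <= b /\ 0 <= g x].
have Ab : A b by split; rewrite ?lexx ?ltW.
have lbA : has_lbound A by exists 0 => x [/andP[]].
pose l := inf A.
have l0 : 0 <= l by apply: lb_le_inf; [exists b|move=> x [/andP[]]].
have lb : l <= b by exact: ge_inf.
have neg x : 0 <= x -> x < l -> g x < 0.
  move=> x0 xl; rewrite ltNge; apply/negP => gx.
  have : l <= x by apply: ge_inf => //; split => //; rewrite x0/=; lra.
  by lra.
have pos x : l < x -> x <= b -> 0 < g x.
  move=> lx; rewrite le_eqVlt => /predU1P[->//|xb].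
  have [y [/andP[y0 yb] gy] yx] : exists2 y, A y & y < x.
    have xl0 : 0 < x - l by rewrite subr_gt0.
    have [y Ay yl] := inf_adherent xl0 (conj (ex_intro _ b Ab) lbA).
    by exists y => //; move: yl; rewrite -/l; lra.
  have := three y x b _ yx (ltW xb) (lexx b).
  have -> : a <= y by lra.
  move=> /(_ isT) H.
  have h1 : 0 <= (b - x) * g y by rewrite mulr_ge0// subr_ge0 ltW.
  have h2 : 0 < (x - y) * g b by rewrite mulr_gt0// subr_gt0.
  have : 0 < (b - y) * g x by lra.
  by rewrite pmulr_rgt0// subr_gt0 (lt_trans yx).
have gl0 : 0 <= g l.
  rewrite leNgt; apply/negP => gl.
  have lltb : l < b by rewrite lt_neqAle lb andbT; apply/eqP => E; move: gl gb; rewrite E; lra.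
  (* So close to [l], the value [g a] weighs too little in the chord from [a] to [x] to let [g l] be
     negative when [g x > 0]. *)
  pose k := - g l * (l - a) / (2 * (`|g a| + 1)).
  have ga1 : 0 < `|g a| + 1 by rewrite ltr_wpDl.
  have la : 0 < l - a by lra.
  have gN : 0 < - g l by lra.
  have k0 : 0 < k by rewrite /k divr_gt0// mulr_gt0.
  pose x := l + Num.min (b - l) k.
  have xl : l < x by rewrite /x ltrDl lt_min subr_gt0 lltb.
  have xb : x <= b by rewrite /x -lerBrDl ge_min lexx.
  have xk : x - l <= k by rewrite /x addrC addKr ge_min lexx orbT.
  have := three a l x (lexx a) _ (ltW xl) xb.
  have -> : a < l by lra.
  move=> /(_ isT) H.
  have h1 : 0 <= (l - a) * g x by rewrite mulr_ge0 ?ltW// pos.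
  have h2 : - ((x - l) * (`|g a| + 1)) <= (x - l) * g a.
    rewrite -mulrN ler_wpM2l//; first by rewrite subr_ge0 ltW.
    by have := ler_norm (- g a); rewrite normrN; lra.
  have h3 : (x - l) * (`|g a| + 1) <= - g l * (l - a) / 2.
    apply: le_trans (ler_wpM2r (ltW ga1) xk) _; rewrite /k.
    by rewrite le_eqVlt; apply/orP; left; apply/eqP; field; rewrite gt_eqF.
  have h4 : 0 < - g l * (l - a) by rewrite mulr_gt0.
  have h5 : 0 <= (x - l) * - g l by rewrite mulr_ge0 ?ltW// subr_gt0.
  by lra.
have lp : 0 < l by rewrite lt_neqAle l0 andbT; apply/eqP => E; move: gl0; rewrite -E; lra.
have gl : g l = 0.
  apply/eqP; rewrite eq_le gl0 andbT leNgt; apply/negP => gl.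
  (* If [g l > 0], the chord from [0] to [l] is still positive at [l - dl], where [g] is
     negative. *)
  pose k := l * g l / (2 * - g 0).
  have g0N : 0 < - g 0 by lra.
  have k0 : 0 < k by rewrite /k divr_gt0 ?mulr_gt0.
  pose dl := Num.min (l / 2) k.
  have dl0 : 0 < dl by rewrite lt_min k0 divr_gt0.
  have dl2 : dl <= l / 2 by rewrite ge_min lexx.
  have dlk : dl <= k by rewrite ge_min lexx orbT.
  have := three 0 (l - dl) l (ltW a0) _ _ lb.
  have -> : 0 < l - dl by lra.
  have -> : l - dl <= l by lra.
  move=> /(_ isT isT) H.
  have n1 : g (l - dl) < 0 by apply: neg; lra.
  have h1 : (l - 0) * g (l - dl) < 0 by rewrite subr0 pmulr_rlt0.
  have h2 : l / 2 * g l <= (l - dl - 0) * g l by rewrite ler_wpM2r ?(ltW gl)//; lra.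
  have h3 : dl * - g 0 <= l / 2 * g l.
    apply: le_trans (ler_wpM2r (ltW g0N) dlk) _; rewrite /k.
    by rewrite le_eqVlt; apply/orP; left; apply/eqP; field; rewrite lt_eqF.
  by lra.
exists l; split => //.
- by rewrite lt_neqAle lb andbT; apply/eqP => E; move: gb; rewrite -E gl ltxx.
- by move=> x /andP[x0 xl]; apply: neg => //; exact: ltW.
- by move=> x /andP[lx xb]; exact: pos.
Qed.

End Dispersion.

(** * The hypotheses on [f] transferred to its extension *)

Section BoxNonlinearity.
Set Implicit Arguments. Unset Strict Implicit. Unset Printing Implicit Defensive.
Context {R : realType}.
Variables (K : R) (f : R -> R -> R).
Hypothesis K0 : 0 < K.

Lemma extend_box u v : 0 <= u <= K -> 0 <= v <= K -> extend K f u v = f u v.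
Proof. by move=> uK vK; rewrite /extend !clamp_id. Qed.

(** When [a2 = 0], monotonicity in [v] reduces the lower bound to [v = 0], which removes [v] from
    the error term. *)
Lemma extend_tangent a1 a2 s M : 0 <= a2 ->
  (forall u v v', v <= v' -> extend K f u v <= extend K f u v') ->
  (forall u v, box K (u, v) -> 0 <= a1 * u + a2 * v - f u v <= M * (u + v) `^ (1 + s)) ->
  tangent K a1 a2 s M (extend K f).
Proof.
move=> a20 mono bnd u v uK vK.
have /andP[up lo] := bnd u v (conj uK vK).
rewrite (extend_box uK vK); apply/andP; split; last by rewrite -subr_ge0.
rewrite /active; have [a2E|a2p] := a2_cases a20; last by rewrite a2p mul1r lerBlDl -lerBlDr.
have zK : 0 <= (0 : R) <= K by rewrite lexx ltW.
have := bnd u 0 (conj uK zK); rewrite a2E ltxx !mul0r !addr0 => /andP[_].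
have : f u 0 <= f u v.
  by rewrite -!extend_box//; apply: mono; case/andP: vK.
by lra.
Qed.

(** Differentiability controls [w] within [r] of [u]; beyond that, the oscillation [2 * B] is at
    most [2 * B / r] times the distance. The constant depends on the point. *)
Lemma extend_lip_at D1 B : is_partial1_on K f D1 -> (forall u v, `|extend K f u v| <= B) ->
  forall u v, 0 <= u <= K -> 0 <= v <= K -> exists2 C, 0 <= C &
    forall w, 0 <= w <= K -> `|extend K f w v - extend K f u v| <= C * `|w - u|.
Proof.
move=> hD FB u v uK vK.
have B0 : 0 <= B by exact: le_trans (normr_ge0 _) (FB 0 0).
have [r r0 hr] := has_deriv_withinP (hD u v (conj uK vK)) ltr01.
have C0 : 0 <= 2 * B / r by rewrite divr_ge0 ?mulr_ge0// ltW.
exists (`|D1 u v| + 1 + 2 * B / r); first by rewrite !addr_ge0.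
move=> w wK; have [wr|wr] := ltP `|w - u| r.
  have := hr w wK wr; rewrite mul1r -!(extend_box _ vK)//.
  have := ler_normD (extend K f w v - extend K f u v - D1 u v * (w - u)) (D1 u v * (w - u)).
  rewrite subrK normrM.
  by have := mulr_ge0 C0 (normr_ge0 (w - u)); lra.
have : 2 * B <= 2 * B / r * `|w - u|.
  rewrite -[X in X <= _](divfK (_ : r != 0)) ?gt_eqF//.
  by rewrite ler_wpM2l.
have : 0 <= (`|D1 u v| + 1) * `|w - u| by rewrite mulr_ge0// addr_ge0.
have := ler_normB (extend K f w v) (extend K f u v).
by have := FB w v; have := FB u v; lra.
Qed.

End BoxNonlinearity.

(** * Choice of the exponents and constants, and conclusion *)

Theorem theorem3p1 (R : realType) (d tau K : R) (f D1 D2 : R -> R -> R)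
    (h : R -> R) (lam0 : \bar R) (cstar : R) :
  0 < d -> 0 <= tau -> 0 < K ->
  (* partial derivatives of f exist on [0,K]^2 *)
  is_partial1_on K f D1 -> is_partial2_on K f D2 ->
  (* (F1) *)
  {within box K, continuous (fun p : R * R => f p.1 p.2)} ->
  f 0 0 = 0 -> f K K = 0 ->
  (forall u, 0 < u < K -> 0 < f u u) ->
  (forall u v, box K (u, v) -> 0 <= D2 u v) ->
  (* (F2) *)
  (exists M sigma : R, 0 < M /\ 0 < sigma <= 1 /\
     forall u v, box K (u, v) ->
       0 <= D1 0 0 * u + D2 0 0 * v - f u v <= M * (u + v) `^ (1 + sigma)) ->
  D1 K K + D2 K K < 0 ->
  (* (H1) *)
  (forall x, 0 <= h x) -> (forall x, h (- x) = h x) ->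
  lebesgue_measure.-integrable setT (EFin \o h) ->
  (\int[lebesgue_measure]_x (h x)%:E = 1%:E)%E ->
  (* (H2) *)
  (0 < lam0)%E ->
  (forall lam : R, (lam%:E < lam0)%E ->
     (\int[lebesgue_measure]_(x in [set x : R | (0 <= x)%R])
        (h x * expR (lam * x))%:E < +oo)%E) ->
  (* definition of c^* (with lambda^+ = lam0 if D2 0 0 > 0, +oo otherwise) *)
  let lamplus : \bar R := if 0 < D2 0 0 then lam0 else +oo%E in
  let Del := Delta d tau (D1 0 0) (D2 0 0) h in
  0 < cstar ->
  (exists lamstar : R, 0 < lamstar /\ (lamstar%:E < lamplus)%E /\
     Del cstar lamstar = 0 /\ is_derive lamstar 1 (Del cstar) 0) ->
  (forall c' l' : R, 0 < l' -> (l'%:E < lamplus)%E ->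
     Del c' l' = 0 -> is_derive l' 1 (Del c') 0 -> c' = cstar) ->
  (* conclusion *)
  forall c : R, cstar < c ->
  exists lam : R,
    (* lam = lambda_1(c), the smallest positive zero of Delta(c, .) *)
    [/\ 0 < lam, (lam%:E < lamplus)%E, Del c lam = 0 &
        forall l, 0 < l < lam -> Del c l <> 0] /\
  exists phi : R -> R,
    is_travelling_wave d tau K f h c phi /\
    (forall xi, 0 < phi xi < K) /\
    (forall xi, 0 < derive1 phi xi) /\
    (phi xi * expR (- lam * xi) @[xi --> -oo] --> (1 : R)) /\
    (derive1 phi xi * expR (- lam * xi) @[xi --> -oo] --> lam).
Proof.
move=> d0 tau0 K0 hD1 hD2 fc f00 fKK fdiag D2ge0 [M [s [M0 [/andP[s0 s1] bnd]]]].
set a1 := D1 0 0 in bnd *; set a2 := D2 0 0 in bnd *.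
move=> _ h0 even hint h1 lam00 hexp lamplus Del cs0 [ls [ls0 [lsp [Dls _]]]] _ c csc.
have c0 : 0 < c := lt_trans cs0 csc.
have a20 : 0 <= a2 by apply: D2ge0; split; rewrite /= lexx ltW.
have intE p : `|p| <= ls -> 0 < a2 -> exp_integrable h p.
  move=> pls a2p; apply: (even_exp_integrable h0 even hint hexp).
  by move: lsp; rewrite /lamplus a2p; apply: le_lt_trans; rewrite lee_fin.
have absle p : - ls <= p <= ls -> `|p| <= ls by rewrite ler_norml.
have K2 : 0 < K / 2 < K by lra.
(* On the diagonal (F2) gives [f(u, u) <= (a1 + a2) u], and the left side is positive at [K / 2];
   since [h] has mass one, [Delta(c, 0) = - (a1 + a2)]. *)
have a12 : 0 < a1 + a2.
  have bK : box K (K / 2, K / 2) by split=> /=; lra.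
  have /andP[b1 _] := bnd _ _ bK; have := fdiag _ K2.
  have : a1 * (K / 2) + a2 * (K / 2) = (a1 + a2) * (K / 2) by ring.
  move=> E f0; have : 0 < (a1 + a2) * (K / 2) by lra.
  by rewrite pmulr_lgt0//; case/andP: K2.
have D0 : Del c 0 < 0.
  rewrite /Del /Delta mulr0 oppr0 !mul0r expR0.
  have -> : Gfun h 0 = 1.
    rewrite /Gfun; under eq_Rintegral do rewrite oppr0 mul0r expR0 mulr1.
    by rewrite /Rintegral h1.
  by lra.
(* [Delta] increases strictly with the speed at a positive exponent, because the delay factor does
   not increase. *)
have Dls0 : 0 < Del c ls.
  have e : expR (- ls * c * tau) <= expR (- ls * cstar * tau).
    by rewrite ler_expR ler_wpM2r// !mulNr lerN2 ler_wpM2l ?(ltW ls0) ?(ltW csc).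
  have := ler_wpM2r (Gfun_ge0 h0 ls) (ler_wpM2l a20 e).
  have : cstar * ls < c * ls by rewrite ltr_pM2r.
  by move: Dls; rewrite /Del /Delta; lra.
have [l [l0 lls Dl neg pos]] : exists l, [/\ 0 < l, l < ls, Del c l = 0,
    forall x, 0 < x < l -> Del c x < 0 & forall x, l < x <= ls -> 0 < Del c x].
  (* Evenness of [h] gives the exponential moments on the symmetric interval, hence concavity on
     both sides of zero. *)
  apply: (concave_first_zero (a := - ls)) => //; first by rewrite oppr_lt0.
  move=> x y t xls yls t01; apply: Delta_concave => //; first exact: ltW.
  move=> a2p; split; apply: intE => //; apply: absle => //.
  move: t01 xls yls => /andP[t0 t1] /andP[x1 x2] /andP[y1 y2].
  have t1' : 0 <= 1 - t by lra.
  have := ler_wpM2l t0 x1; have := ler_wpM2l t0 x2.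
  have := ler_wpM2l t1' y1; have := ler_wpM2l t1' y2.
  by move=> *; apply/andP; split; lra.
exists l; split.
  split => //; last by move=> x /neg; rewrite lt_neqAle => /andP[/eqP].
  by apply: lt_trans lsp; rewrite lte_fin.
(* Staying below [ls] ensures [Delta(c, m) > 0] and convergence of the moment when [a2 > 0]; the
   other bound serves the (F2) error. *)
pose m := Num.min ls ((1 + s) * l).
have lm : l < m.
  by rewrite lt_min lls mulrDl mul1r ltrDl mulr_gt0.
have mls : m <= ls by rewrite ge_min lexx.
have ms : m <= (1 + s) * l by rewrite ge_min lexx orbT.
have Dm : 0 < Del c m by apply: pos; rewrite lm.
pose x1 := Num.min 0 (ln K / l).
have x10 : x1 <= 0 by rewrite ge_min lexx.
have x1K : expR (l * x1) <= K.
  rewrite -[X in _ <= X]lnK ?posrE// ler_expR mulrC -ler_pdivlMr//.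
  by rewrite ge_min lexx orbT.
(* The first entry yields [disp_m], the second makes [sub] nonpositive from [x1] on. *)
pose q := Num.max (error_cst tau c a2 h l s M / Del c m) (expR (- ((m - l) * x1))).
have x1q : 1 <= q * expR ((m - l) * x1).
  have : expR (- ((m - l) * x1)) <= q by rewrite le_max lexx orbT.
  move=> /(ler_wpM2r (expR_ge0 ((m - l) * x1))); apply: le_trans.
  by rewrite -expRD addNr expR0.
have disp_l : c * l = d * (expR l + expR (- l) - 2) + a1 + nonlocal tau c a2 h l.
  by move: Dl; rewrite /Del /Delta /nonlocal mulrA; lra.
have disp_m : error_cst tau c a2 h l s M <=
    q * (c * m - d * (expR m + expR (- m) - 2) - a1 - nonlocal tau c a2 h m).
  have -> : c * m - d * (expR m + expR (- m) - 2) - a1 - nonlocal tau c a2 h m = Del c m.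
    by rewrite /Del /Delta /nonlocal; ring.
  by rewrite -ler_pdivrMr// le_max lexx.
have q0 : 0 < q by rewrite lt_max expR_gt0 orbT.
have exp_int : 0 < a2 -> exp_integrable h l /\ exp_integrable h m.
  move=> a2p; split; apply: intE => //; first by rewrite gtr0_norm// ltW.
  by rewrite gtr0_norm// (lt_trans l0 lm).
have [B FB] := extend_bounded K0 fc.
have F_unif := extend_unif K0 fc.
have F_mono := extend_le_r K0 fc hD2 D2ge0.
have F_tg := extend_tangent K0 a20 F_mono bnd.
have KK : 0 <= K <= K by rewrite lexx ltW.
have FK : extend K f K K <= 0 by rewrite extend_box// fKK.
have F_lip := extend_lip_at hD1 FB.
have F_diag u : 0 < u < K -> 0 < extend K f u u.
  by move=> /[dup] uK /andP[u1 u2]; rewrite extend_box ?(ltW u1) ?(ltW u2)// fdiag.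
have [phi [adm dphi]] := limit_wave d0 c0 K0 a20 h0 hint h1 l0 lm s0 ms (ltW M0) exp_int
  disp_l disp_m x10 x1K x1q FB F_unif F_mono F_tg FK.
have phi' x : derive1 phi x = wave_rhs d tau c h (extend K f) phi x.
  by rewrite derive1E (@derive_val _ _ _ _ _ _ _ (dphi x)).
exists phi; split; last split; last split; last split.
- split; first by move=> x; case: (dphi x).
  split.
    move=> x; rewrite phi' /wave_rhs extend_box; last 2 first.
    + exact: (adm_itv adm x).
    + exact: (delayed_itv tau c h0 hint h1 x adm).
    by rewrite /delayed; field; rewrite gt_eqF.
  split; first exact: (phi_cvgNy l0 lm q0 adm).
  split; last exact: (adm_itv adm).
  exact: (phi_cvgy d0 c0 h0 hint h1 l0 lm q0 F_unif F_mono F_lip F_diag adm dphi).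
- move=> x; rewrite (phi_gt0 lm q0 adm)/=.
  exact: (phi_ltK d0 c0 h0 hint h1 l0 lm q0 F_mono F_lip adm dphi).
- by move=> x; rewrite phi'; exact: (rhs_gt0 d0 c0 h0 hint h1 l0 lm q0 F_mono F_lip adm).
- exact: (phi_asymptotic lm adm).
- rewrite (_ : (fun x => _) = (fun x => wave_rhs d tau c h (extend K f) phi x * expR (- l * x))).
    exact: (rhs_asymptotic d0 c0 a20 h0 hint h1 l0 lm s0 (ltW M0) q0 exp_int disp_l F_tg adm).
  by apply/funext => x; rewrite phi'.
Qed.
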